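(* Let $s_0\in\mathcal{D}$ be a new location (not among the observed ones), let $\mathbb{P}_0$ (with expectation $\mathbb{E}_0$) be the law of the Matérn model with parameters $(\sigma_0^2,\phi_0,\tau_0^2)$ generating $y=(y(s_1),\ldots,y(s_n))^{T}$ and $y(s_0)=z(s_0)+\varepsilon(s_0)$, and let $\mathcal{M}_1,\ldots,\mathcal{M}_G$ be finitely many candidate conjugate Bayesian Matérn models. Let $w^*(y)=(w_1^*(y),\ldots,w_G^*(y))$ be stacking weights, i.e. (measurable) functions of the data $y$ such that, $\mathbb{P}_0$-almost surely, $$\sum_{g=1}^Gw_g^*(y)=1\quad\text{and}\quad w_g^*(y)\ge0\ \text{ for each }1\le g\le G.$$ For each $g$ let $E^g_{1,n}=\mathbb{E}_0\big(z(s_0)-\mathbb{E}_g(z(s_0)\mid y)\big)^2$ be the prediction error (under $\mathbb{P}_0$) of the best linear predictor of $z(s_0)$ for model $\mathcal{M}_g$, and assume that $E^g_{1,n}\to0$ as $n\to\infty$ for each model $\mathcal{M}_g$. Then $$\mathbb{E}_0\left(y(s_0)-\sum_{g=1}^Gw_g^*(y)\,\mathbb{E}_g(y(s_0)\mid y)\right)^2\to\tau_0^2\quad\text{as }n\to\infty.$$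
   Context: Matérn model with parameters $(\sigma^2,\phi,\tau^2)$ and smoothness $\nu>0$ (all positive): $y(s)=z(s)+\varepsilon(s)$, $s\in\mathcal{D}\subset\mathbb{R}^d$, where $z$ is a zero-mean Gaussian process with covariance $\sigma^2R_\Phi(s,s')$, $\Phi=(\phi,\nu)$, $\varepsilon$ is a Gaussian white noise process independent of $z$ (independent $\mathcal{N}(0,\tau^2)$ variables at distinct locations), and $$R_\Phi(s,s')=\frac{(\phi|s-s'|)^{\nu}}{\Gamma(\nu)2^{\nu-1}}K_\nu(\phi|s-s'|),\qquad R_\Phi(s,s)=1,$$ with $K_\nu$ the modified Bessel function of the second kind. The observed locations are $\chi=\{s_1,\ldots,s_n\}\subset\mathcal{D}$. Candidate model $\mathcal{M}_g$: with fixed values $\Phi_g=(\phi_g,\nu_g)$ and $\delta_g^2>0$, given $\sigma^2$ the process $y(\cdot)$ follows the Matérn model with partial sill $\sigma^2$, correlation $R_{\Phi_g}$ and nugget $\delta_g^2\sigma^2$, and $\sigma^2\sim\mathrm{IG}(a_\sigma,b_\sigma)$ (inverse gamma, fixed $a_\sigma,b_\sigma>0$). $\mathbb{E}_g(\cdot\mid y)$ is the posterior (predictive) expectation given $y$ under $\mathcal{M}_g$. One has $\mathbb{E}_g(y(s_0)\mid y)=\mathbb{E}_g(z(s_0)\mid y)=J_g^{T}(\delta_g^2I_n+R_g)^{-1}y$ with $R_g=(R_{\Phi_g}(s_i,s_j))_{i,j}$ and $J_g=(R_{\Phi_g}(s_i,s_0))_i$, which is the best linear predictor of $z(s_0)$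 under any Matérn model with correlation $R_{\Phi_g}$ and nugget-to-sill ratio $\delta_g^2$. The weights may depend on $n$; an example is $w^*(y)$ minimizing $\sum_{i=1}^n\big(y(s_i)-\sum_gw_g\hat y_g(s_i)\big)^2$ over the simplex, where $\hat y_g(s_i)$ is the leave-one-out posterior predictive mean of $y(s_i)$ under $\mathcal{M}_g$ given the data without the $i$-th observation. *)

(* Defs.v *)
From HB Require Import structures.
From mathcomp Require Import all_boot all_order all_algebra.
From mathcomp Require Import all_classical all_reals all_analysis.
From mathcomp Require Import measurable_realfun.

Set Implicit Arguments.
Unset Strict Implicit.
Unset Printing Implicit Defensive.

Import Order.TTheory GRing.Theory Num.Theory.
Import numFieldNormedType.Exports.

Local Open Scope classical_set_scope.
Local Open Scope ring_scope.

Section MaternCorrelation.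
Context {R : realType}.

(* Euler integral of the second kind, used for a > 0. *)
Definition Gamma_fun (a : R) : R :=
  \int[lebesgue_measure]_(t in `]0, +oo[) (t `^ (a - 1) * expR (- t)).

Definition coshR (x : R) : R := (expR x + expR (- x)) / 2.

(* Modified Bessel function of the second kind of order nu, at x > 0, by its
   integral representation K_nu(x) = int_0^oo exp(-x cosh t) cosh(nu t) dt. *)
Definition besselK (nu x : R) : R :=
  \int[lebesgue_measure]_(t in `[0, +oo[)
    (expR (- (x * coshR t)) * coshR (nu * t)).

(* The library norm on 'rV[R]_p is the sup norm, hence this definition. *)
Definition euclid_norm p (x : 'rV[R]_p) : R :=
  Num.sqrt (\sum_(j < p) x ord0 j ^+ 2).

Definition matern_corr p (phi nu : R) (s t : 'rV[R]_p) : R :=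
  if s == t then 1
  else let r := phi * euclid_norm (s - t) in
       r `^ nu / (Gamma_fun nu * 2 `^ (nu - 1)) * besselK nu r.

(* IG(a, b): shape a, scale b (the density is proportional to
   x^(-a-1) exp(-b/x)). *)
Definition inverse_gamma_pdf (a b x : R) : R :=
  if 0 < x then b `^ a / Gamma_fun a * x `^ (- a - 1) * expR (- (b / x))
  else 0.

End MaternCorrelation.

Section Probability.
Context {R : realType} {d : measure_display} {T : measurableType d}.
Variable P : probability T R.

(* normal_prob m 0 is not a point mass in the library, so the degenerate
   Gaussian laws are added explicitly. *)
Definition gaussian_law (m sd : R) (A : set R) : \bar R :=
  if sd == 0 then \d_m A else normal_prob m sd A.

Definition gaussian_variable (X : T -> R) : Prop :=
  exists m sd : R, forall A : set R, measurable A ->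
    P (X @^-1` A) = gaussian_law m sd A.

Definition gaussian_process (I : Type) (D : set I)
    (X : I -> {mfun T >-> R}) : Prop :=
  forall n (t : n.-tuple I) (c : n.-tuple R), (forall i, D (tnth t i)) ->
    gaussian_variable (fun x => \sum_(i < n) tnth c i * X (tnth t i) x).

Definition mutually_independent (I : eqType) (D : set I)
    (X : I -> {mfun T >-> R}) : Prop :=
  forall n (t : n.-tuple I) (A : 'I_n -> set R),
    uniq t -> (forall i, D (tnth t i)) -> (forall i, measurable (A i)) ->
    P (\bigcap_(i in [set: 'I_n]) (X (tnth t i) @^-1` A i)) =
    (\prod_(i < n) P (X (tnth t i) @^-1` A i))%E.

Definition gaussian_white_noise (I : eqType) (D : set I)
    (e : I -> {mfun T >-> R}) (tau2 : R) : Prop :=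
  mutually_independent D e /\
  forall s, D s -> forall A : set R, measurable A ->
    P (e s @^-1` A) = normal_prob 0 (Num.sqrt tau2) A.

Definition process_sigma_algebra (I : Type) (D : set I)
    (X : I -> {mfun T >-> R}) : set (set T) :=
  <<s \bigcup_(s in D) preimage_set_system [set: T] (X s) measurable >>.

Definition independent_processes (I : Type) (D : set I)
    (X Y : I -> {mfun T >-> R}) : Prop :=
  forall A B, process_sigma_algebra D X A -> process_sigma_algebra D Y B ->
    P (A `&` B) = (P A * P B)%E.

(* k is a regular conditional distribution of X given Y under P. *)
Definition conditional_law d1 d2 (T1 : measurableType d1)
    (T2 : measurableType d2) (Y : T -> T1) (X : T -> T2)
    (k : T1 -> probability T2 R) : Prop :=
  (forall A, measurable A -> measurable_fun [set: T1] (fun y => k y A)) /\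
  forall A B, measurable A -> measurable B ->
    P (X @^-1` A `&` Y @^-1` B) = (\int[P]_(x in Y @^-1` B) k (Y x) A)%E.

(* The latent process z and the noise e, on the domain D, form the Matern
   model with partial sill sigma2, decay phi, smoothness nu and nugget tau2. *)
Definition matern_model p (D : set 'rV[R]_p) (z e : 'rV[R]_p -> {mfun T >-> R})
    (sigma2 phi nu tau2 : R) : Prop :=
  [/\ gaussian_process D z,
      forall s, D s -> ('E_P[z s] = 0)%E,
      forall s t, D s -> D t ->
        covariance P (z s) (z t) = (sigma2 * matern_corr phi nu s t)%:E,
      gaussian_white_noise D e tau2 &
      independent_processes D z e].

End Probability.

Section Observations.
Context {R : realType} {d : measure_display} {T : measurableType d} {p : nat}.

Definition response (z e : 'rV[R]_p -> {mfun T >-> R}) (s : 'rV[R]_p)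
  (x : T) : R := z s x + e s x.

Definition data (z e : 'rV[R]_p -> {mfun T >-> R}) n (s : n.-tuple 'rV[R]_p)
  (x : T) : n.-tuple R := [tuple response z e (tnth s i) x | i < n].

End Observations.

(* A conjugate Bayesian Matern model: the prior on the partial sill is
   IG(ig_shape, ig_scale) and, given that the partial sill is v, the process
   follows the Matern model with partial sill v and nugget nugget_ratio * v.
   [given_sill v] is the conditional probability on the sample space given
   that the partial sill is v. *)
Record bayes_matern (R : realType) (p : nat) (D : set 'rV[R]_p) := BayesMatern {
  decay : R;
  smoothness : R;
  nugget_ratio : R;
  ig_shape : R;
  ig_scale : R;
  decay_gt0 : 0 < decay;
  smoothness_gt0 : 0 < smoothness;
  nugget_ratio_gt0 : 0 < nugget_ratio;
  ig_shape_gt0 : 0 < ig_shape;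
  ig_scale_gt0 : 0 < ig_scale;
  model_display : measure_display;
  model_space : measurableType model_display;
  model_prob : probability model_space R;
  sill : {mfun model_space >-> R};
  latent : 'rV[R]_p -> {mfun model_space >-> R};
  noise : 'rV[R]_p -> {mfun model_space >-> R};
  given_sill : R -> probability model_space R;
  sill_prior : forall A : set R, measurable A ->
    model_prob (sill @^-1` A) =
    (\int[lebesgue_measure]_(v in A)
       (inverse_gamma_pdf ig_shape ig_scale v)%:E)%E;
  given_sillP : conditional_law model_prob sill id given_sill;
  given_sill_matern : forall v : R, 0 < v ->
    matern_model (given_sill v) D latent noise v decay smoothness
      (nugget_ratio * v)
}.

Section Posterior.
Context {R : realType} {p : nat} {D : set 'rV[R]_p} (M : bayes_matern D).
Context {n : nat} (s : n.-tuple 'rV[R]_p) (s0 : 'rV[R]_p).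

Definition latent_posterior (k : n.-tuple R -> probability R R) : Prop :=
  conditional_law (model_prob M) (data (latent M) (noise M) s)
    (latent M s0) k.

Definition response_posterior (k : n.-tuple R -> probability R R) : Prop :=
  conditional_law (model_prob M) (data (latent M) (noise M) s)
    (response (latent M) (noise M) s0) k.

End Posterior.

(* Mean of the posterior law k y. It is taken of the posterior law rather than
   as an L1 conditional expectation since for ig_shape <= 1/2 the process is
   not integrable under the prior, whereas its posterior law given n >= 1
   observations always has a mean (for almost every y). *)
Definition posterior_mean {R : realType} {n : nat}
    (k : n.-tuple R -> probability R R) (y : n.-tuple R) : R :=
  \int[k y]_u u.

(* Main.v *)
Require Import Defs.
From HB Require Import structures.
From mathcomp Require Import all_boot all_order all_algebra.
From mathcomp Require Import all_classical all_reals all_analysis.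
From mathcomp Require Import measurable_realfun.
From mathcomp Require Import ring lra giry.

Import Order.TTheory GRing.Theory Num.Theory.
Import numFieldNormedType.Exports.

Local Open Scope classical_set_scope.
Local Open Scope ring_scope.

(**
Put X_n = z(s_0) - sum_g w_g(y) E_g(z(s_0) | y). Since the weights are almost
surely convex, X_n^2 is at most the sum of the squared errors of the candidate
models, so that E_0 X_n^2 tends to 0. As the prediction error of the stacked
predictor is eps(s_0) + X_n, its second moment tends to that of eps(s_0), by
(a + b)^2 <= (1 + c) a^2 + (1 + 1/c) b^2; the cross term need not vanish.

This uses E_g(y(s_0) | y) = E_g(z(s_0) | y) for P_0-almost every y. The posterior
means are only determined up to null sets of the law of y under M_g, but the
laws of y under P_0 and under M_g have the same null sets, because of the
independent nondegenerate Gaussian noise. Under M_g, eps(s_0) is centered and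
independent of y given the partial sill, which gives the equality of the
conditional means once integrability is settled. The process may fail to be
integrable under the prior; it is integrable on each event |y(s_i)| <= K, and
these events exhaust the space.
*)

(** * Image measures and the normal law *)

(** The kernels [kz] and [ky] are arbitrary versions of the conditional laws, so the posterior means
    come without a closed formula: they are compared through their integrals over events y in B. The
    obstacle is finiteness. Given the partial sill v, E|z(s_0)| is of order v^(1/2), which an
    inverse gamma prior with small shape does not integrate; but the noise density is O(v^(-1/2)),
    so given v and the latent process a bounded range for one observation has probability
    O(v^(-1/2)), and the two orders cancel. Disintegrations are carried out on nonnegative
    integrands, where they hold unconditionally; integrability enters only when positive and
    negative parts are subtracted. The law of y under M_g is a mixture over v, and a null set of the
    mixture is null for at least one v > 0, which is enough to compare it with P_0. *)

Section ImageMeasure.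
Context {d1 d2 : measure_display} {T1 : measurableType d1}
  {T2 : measurableType d2} {R : realType}.

Definition image_measure (m : {measure set T1 -> \bar R}) (f : T1 -> T2)
  (mf : measurable_fun [set: T1] f) : {measure set T2 -> \bar R} :=
  measure_function_pushforward__canonical__measure_function_Measure m mf.

Definition image_prob (P : probability T1 R) (f : T1 -> T2)
    (mf : measurable_fun [set: T1] f) : probability T2 R :=
  let X : {mfun T1 >-> T2} := HB.pack f (isMeasurableFun.Build _ _ _ _ _ mf) in
  distribution P X.

Lemma image_probE (P : probability T1 R) (f : T1 -> T2)
    (mf : measurable_fun [set: T1] f) (A : set T2) :
  image_prob P f mf A = P (f @^-1` A).
Proof. by []. Qed.

Lemma ge0_integral_image_prob (P : probability T1 R) (f : T1 -> T2)
    (mf : measurable_fun [set: T1] f) (g : T2 -> \bar R) :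
  measurable_fun [set: T2] g -> (forall y, 0 <= g y)%E ->
  (\int[image_prob P f mf]_y g y = \int[P]_x g (f x))%E.
Proof. by move=> mg g0; rewrite ge0_integral_distribution. Qed.

End ImageMeasure.

(** * Translation and reflection invariance of Lebesgue measure *)

Section LebesgueAffine.
Context {R : realType}.
Local Notation mu := (@lebesgue_measure R).

(** Lebesgue measure is characterized by its values on the intervals ]c, d], and its image under a
    translation takes the same values there. *)
Lemma lebesgue_measure_shift (a : R) (A : set R) : measurable A ->
  mu ((fun x => a + x) @^-1` A) = mu A.
Proof.
move=> mA.
have mf : measurable_fun [set: measurableTypeR R]
    ((fun x => a + x) : measurableTypeR R -> measurableTypeR R).
  exact: measurable_funD.
apply/esym; change (mu A = image_measure mu _ mf A).
apply: lebesgue_measure_unique => // X [[c d] _ <-] /=.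
rewrite /pushforward /=.
have -> : (fun x => a + x) @^-1` `]c, d] = `]c - a, d - a]%classic.
  by apply/seteqP; split => x /=; rewrite !in_itv/= => /andP[? ?]; apply/andP; split; lra.
rewrite !lebesgue_measure_itv/= !lte_fin ltrD2r.
by case: ifP => // _; rewrite -!EFinD; congr EFin; ring.
Qed.

Lemma lebesgue_measure_opp (A : set R) : measurable A ->
  mu (-%R @^-1` A) = mu A.
Proof.
move=> mA.
have mf : measurable_fun [set: measurableTypeR R]
    (-%R : measurableTypeR R -> measurableTypeR R).
  exact: oppr_measurable.
apply/esym; change (mu A = image_measure mu _ mf A).
apply: lebesgue_measure_unique => // X [[c d] _ <-] /=.
rewrite /pushforward /=.
have -> : -%R @^-1` `]c, d] = `[- d, - c[%classic.
  by apply/seteqP; split => x /=; rewrite !in_itv/= => /andP[? ?]; apply/andP; split; lra.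
rewrite !lebesgue_measure_itv/= !lte_fin ltrN2.
by case: ifP => // _; rewrite -!EFinD; congr EFin; ring.
Qed.

End LebesgueAffine.

Section Normal.
Context {R : realType}.
Local Notation mu := (@lebesgue_measure R).

Lemma lebesgue_null_normal_null (m s : R) (A : set R) : measurable A ->
  mu A = 0%E -> normal_prob m s A = 0%E.
Proof.
move=> mA A0.
by move/null_content_dominatesP: (normal_prob_dominates m s); apply.
Qed.

(** The density is positive everywhere, so its integral over A vanishes only if A is
    Lebesgue-null. *)
Lemma normal_null_lebesgue_null (m s : R) (A : set R) : s != 0 ->
  measurable A -> normal_prob m s A = 0%E -> mu A = 0%E.
Proof.
move=> s0 mA; rewrite /normal_prob => h.
have p0 x : 0 < normal_pdf m s x.
  by rewrite normal_pdfE// mulr_gt0 ?normal_peak_gt0 ?expR_gt0.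
have mp : measurable_fun A (EFin \o normal_pdf m s).
  by apply/measurable_EFinP/measurable_funTS; exact: measurable_normal_pdf.
have : (\int[mu]_(x in A) `|(normal_pdf m s x)%:E| = 0)%E.
  by rewrite -[RHS]h; apply: eq_integral => x _; rewrite gee0_abs// lee_fin ltW.
move/(ae_eq_integral_abs mu mA mp) => [N [mN N0 AN]].
apply: (subset_measure0 _ _ _ N0) => // x Ax; apply: AN => /= /(_ Ax) /eqP.
by rewrite eqe gt_eqF.
Qed.

(** The change of variables produces the Radon-Nikodym derivative; it has the same integrals as
    [normal_pdf] over all measurable sets, hence agrees with it almost everywhere. *)
Lemma ge0_integral_normal_prob (m s : R) (f : R -> \bar R) :
  measurable_fun [set: R] f -> (forall x, 0 <= f x)%E ->
  (\int[normal_prob m s]_x f x =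
   \int[mu]_x (f x * (normal_pdf m s x)%:E))%E.
Proof.
move=> mf f0.
have dom := normal_prob_dominates m s.
rewrite -(Radon_Nikodym_SigmaFinite.change_of_variables dom)//=.
have mg := measurable_int _ (Radon_Nikodym_SigmaFinite.f_integrable dom).
apply: ge0_ae_eq_integral => //.
- exact: emeasurable_funM.
- by apply: emeasurable_funM => //; apply/measurable_EFinP; exact: measurable_normal_pdf.
- by move=> x _; rewrite mule_ge0// Radon_Nikodym_SigmaFinite.f_ge0.
- by move=> x _; rewrite mule_ge0// lee_fin normal_pdf_ge0.
- apply: ae_eqe_mul2l => /=; apply: integral_ae_eq => //=.
  + exact: Radon_Nikodym_SigmaFinite.f_integrable.
  + by apply/measurable_EFinP; exact: measurable_normal_pdf.
  + by move=> E _ mE; rewrite -Radon_Nikodym_SigmaFinite.f_integral.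
Qed.

Lemma normal_prob_itv_le (m s a b : R) : s != 0 -> a <= b ->
  (normal_prob m s `[a, b]%classic <= (normal_peak s * (b - a))%:E)%E.
Proof.
move=> s0 ab; rewrite /normal_prob.
apply: (@le_trans _ _ (\int[mu]_(x in `[a, b]) (normal_peak s)%:E)%E).
  apply: ge0_le_integral => //.
  - by move=> x _; rewrite lee_fin normal_pdf_ge0.
  - by apply/measurable_EFinP/measurable_funTS; exact: measurable_normal_pdf.
  - by move=> x _; rewrite lee_fin normal_pdf_ub.
rewrite integral_cst//= lebesgue_measure_itv/= lte_fin.
case: ltP => [_|ba]; first by rewrite -EFinD -EFinM.
by rewrite mule0 lee_fin mulr_ge0 ?normal_peak_ge0 ?subr_ge0.
Qed.

Lemma normal_prob_sym (s : R) (f : R -> \bar R) : s != 0 ->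
  measurable_fun [set: R] f -> (forall x, 0 <= f x)%E ->
  (\int[normal_prob 0 s]_x f (- x)%R = \int[normal_prob 0 s]_x f x)%E.
Proof.
move=> s0 mf f0.
have mN : measurable_fun [set: measurableTypeR R]
    (-%R : measurableTypeR R -> measurableTypeR R).
  exact: oppr_measurable.
rewrite !ge0_integral_normal_prob//; last exact: measurableT_comp.
have mg : measurable_fun [set: R] (fun x => f x * (normal_pdf 0 s x)%:E)%E.
  by apply: emeasurable_funM => //; apply/measurable_EFinP; exact: measurable_normal_pdf.
have g0 x : (0 <= f x * (normal_pdf 0 s x)%:E)%E.
  by rewrite mule_ge0// lee_fin normal_pdf_ge0.
transitivity (\int[image_measure mu _ mN]_x (f x * (normal_pdf 0 s x)%:E))%E; last first.
  apply: eq_measure_integral.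
  by move=> A mA _; exact: lebesgue_measure_opp.
rewrite (ge0_integral_pushforward mN mu measurableT mg (fun x _ => g0 x)).
rewrite preimage_setT; apply: eq_integral => x _ /=.
by rewrite !normal_pdfE//= /normal_fun !subr0 sqrrN.
Qed.

(** The route goes through Lebesgue-null sets, which are translation invariant; this is why shift
    and scale may both change. *)
Lemma normal_null_shift (a a' s s' : R) (A : set R) : s != 0 -> measurable A ->
  normal_prob 0 s ((fun x => a + x) @^-1` A) = 0%E ->
  normal_prob 0 s' ((fun x => a' + x) @^-1` A) = 0%E.
Proof.
move=> s0 mA.
have mshift b : measurable ((fun x : R => b + x) @^-1` A).
  by rewrite -[X in measurable X]setTI; exact: measurable_funD.
move=> /(normal_null_lebesgue_null 0 s _ s0 (mshift a)).
rewrite lebesgue_measure_shift// => A0; apply: lebesgue_null_normal_null => //.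
by rewrite lebesgue_measure_shift.
Qed.

End Normal.

(** * The second moment of a centered normal law *)

Section SecondMoment.
Context {R : realType}.
Local Notation mu := (@lebesgue_measure R).

Lemma ge0_integral_split_itvcy (f : R -> R) (a : R) : 0 <= a ->
  measurable_fun [set: R] f -> (forall x, 0 <= x -> 0 <= f x) ->
  (\int[mu]_(x in `[0%R, +oo[) (f x)%:E =
   \int[mu]_(x in `[0%R, a]) (f x)%:E + \int[mu]_(x in `[a, +oo[) (f x)%:E)%E.
Proof.
move=> a0 mf f0.
have mfE A : measurable_fun A (EFin \o f) by apply/measurable_EFinP/measurable_funTS.
rewrite -(integral_itv_obnd_cbnd (r := a))//.
rewrite -ge0_integral_setU//=.
- by congr integral; rewrite -itv_bndbnd_setU//= bnd_simp.
- exact: mfE.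
- move=> x [|] /=; rewrite in_itv/= lee_fin => /andP[x0 _]; apply: f0 => //.
  exact: le_trans (ltW x0).
- rewrite disj_set2E; apply/eqP/seteqP; split => // x [] /=.
  by rewrite !in_itv/= => /andP[_ xa] /andP[ax _]; move: (le_lt_trans xa ax); rewrite ltxx.
Qed.

Let p (s : R) := normal_peak s.
(** This is -s^2 x f(x), f being the centered normal density, with f expanded. *)
Let G (s x : R) : R := - (s ^+ 2 * p s) * (x * expR (- x ^+ 2 / (s ^+ 2 *+ 2))).

Let normal_pdf0E (s x : R) : 0 < s ->
  normal_pdf 0 s x = p s * expR (- x ^+ 2 / (s ^+ 2 *+ 2)).
Proof. by move=> s0; rewrite normal_pdfE ?gt_eqF//= /normal_fun subr0. Qed.

Let derG (s x : R) : 0 < s ->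
  is_derive x 1 (G s) (x ^+ 2 * normal_pdf 0 s x - s ^+ 2 * normal_pdf 0 s x).
Proof.
move=> s0; rewrite normal_pdf0E// /G.
apply: is_derive_eq; rewrite /GRing.scale/=.
by field; rewrite ?gt_eqF.
Qed.

Let G_cvg (s : R) : 0 < s -> G s x @[x --> +oo] --> 0.
Proof.
move=> s0; rewrite -(mulr0 (- (s ^+ 2 * p s))); apply: cvgMl_tmp.
(* With y = x^2 / (2 s^2), the inequality exp y >= 1 + y >= y bounds x exp(-y) by x / y = 2 s^2 /
   x. *)
apply: (@squeeze_cvgr _ _ _ _ (cst 0) (fun x => (s ^+ 2 *+ 2) * x^-1)).
- near=> x.
  have x0 : 0 < x by near: x; exact: nbhs_pinfty_gt.
  have s2 : 0 < s ^+ 2 *+ 2 by rewrite pmulrn_lgt0// exprn_gt0.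
  have y0 : 0 < x ^+ 2 / (s ^+ 2 *+ 2) by rewrite divr_gt0// exprn_gt0.
  rewrite mulr_ge0 ?expR_ge0 ?(ltW x0)//= mulNr expRN.
  have -> : s ^+ 2 *+ 2 * x^-1 = x / (x ^+ 2 / (s ^+ 2 *+ 2)).
    by field; rewrite !gt_eqF.
  rewrite ler_pM2l// lef_pV2 ?posrE ?expR_gt0//.
  by apply: le_trans (expR_ge1Dx _); rewrite lerDr.
- exact: cvg_cst.
- rewrite -(mulr0 (s ^+ 2 *+ 2)); apply: cvgMl_tmp; apply/gtr0_cvgV0; last exact: cvg_id.
  by near=> x; near: x; exact: nbhs_pinfty_gt.
Unshelve. all: by end_near.
Qed.

(* With G' = (x^2 - s^2) f and f the density, the integrals of x^2 f and s^2 f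
   over [0, s] and [s, +oo[ differ by the same amount -G(s); cutting at s makes
   both integrands of constant sign, so that no limit is needed. *)
Lemma normal_pdf_second_moment (s : R) : 0 < s ->
  (\int[mu]_x (x ^+ 2 * normal_pdf 0 s x)%:E = (s ^+ 2)%:E)%E.
Proof.
move=> s0; have sn0 : s != 0 by rewrite gt_eqF.
have mf : measurable_fun [set: R] (normal_pdf 0 s) by exact: measurable_normal_pdf.
have cf : continuous (normal_pdf 0 s) by exact: continuous_normal_pdf.
have f0 x : 0 <= normal_pdf 0 s x by exact: normal_pdf_ge0.
have fN x : normal_pdf 0 s (- x) = normal_pdf 0 s x by rewrite !normal_pdf0E// sqrrN.
have csq : continuous (fun x : R => x ^+ 2) by exact: exprn_continuous.
have cxf : continuous (fun x : R => x ^+ 2 * normal_pdf 0 s x).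
  by move=> x; apply: cvgM; [exact: csq|exact: cf].
have csf : continuous (fun x : R => s ^+ 2 * normal_pdf 0 s x).
  by move=> x; apply: cvgM; [exact: cvg_cst|exact: cf].
have cB : continuous (fun x : R => x ^+ 2 * normal_pdf 0 s x - s ^+ 2 * normal_pdf 0 s x).
  by move=> x; apply: cvgB; [exact: cxf|exact: csf].
have cB' : continuous (fun x : R => - (x ^+ 2 * normal_pdf 0 s x - s ^+ 2 * normal_pdf 0 s x)).
  by move=> x; apply: cvgN; exact: cB.
have dG x : derivable (G s) x 1 by have [] := derG s x s0.
have cG : continuous (G s).
  by move=> x; apply/differentiable_continuous/derivable1_diffP.
pose c := (- G s s)%:E.
have h2 : (\int[mu]_(x in `[s, +oo[)
    (x ^+ 2 * normal_pdf 0 s x - s ^+ 2 * normal_pdf 0 s x)%:E = c)%E.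
  rewrite (ge0_continuous_FTC2y (F := G s) (l := 0))//.
  - by rewrite add0e.
  - move=> x sx; rewrite -mulrBl mulr_ge0// subr_ge0 lerXn2r ?nnegrE ?(ltW s0)//.
    exact: le_trans (ltW s0) sx.
  - exact: continuous_subspaceT.
  - exact: G_cvg.
  - by apply: cvg_at_right_filter; exact: cG.
  - by move=> x _; rewrite derive1E; have [_] := derG s x s0.
have h1 : (\int[mu]_(x in `[0%R, s])
    (- (x ^+ 2 * normal_pdf 0 s x - s ^+ 2 * normal_pdf 0 s x))%:E = c)%E.
  rewrite (continuous_FTC2 (F := \- G s))//.
  - by rewrite /c /G/= mul0r mulr0 oppr0 sube0.
  - exact: continuous_subspaceT.
  - split.
    + by move=> x _; apply: derivableN.
    + by apply: cvg_at_right_filter; apply: cvgN; exact: cG.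
    + by apply: cvg_at_left_filter; apply: cvgN; exact: cG.
  - move=> x _; rewrite derive1E deriveN//; congr -%R.
    by have [_] := derG s x s0.
have mxf : measurable_fun [set: R] (fun x => x ^+ 2 * normal_pdf 0 s x).
  exact: continuous_measurable_fun.
have msf : measurable_fun [set: R] (fun x => s ^+ 2 * normal_pdf 0 s x).
  exact: continuous_measurable_fun.
have mB : measurable_fun [set: R]
    (fun x => x ^+ 2 * normal_pdf 0 s x - s ^+ 2 * normal_pdf 0 s x).
  exact: continuous_measurable_fun.
have mB' : measurable_fun [set: R]
    (fun x => - (x ^+ 2 * normal_pdf 0 s x - s ^+ 2 * normal_pdf 0 s x)).
  exact: continuous_measurable_fun.
have xf0 x : 0 <= x ^+ 2 * normal_pdf 0 s x by rewrite mulr_ge0// sqr_ge0.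
have sf0 x : 0 <= s ^+ 2 * normal_pdf 0 s x by rewrite mulr_ge0// sqr_ge0.
have half : (\int[mu]_(x in `[0%R, +oo[) (x ^+ 2 * normal_pdf 0 s x)%:E =
             \int[mu]_(x in `[0%R, +oo[) (s ^+ 2 * normal_pdf 0 s x)%:E)%E.
  rewrite (ge0_integral_split_itvcy _ s)//; last exact: ltW.
  rewrite [RHS](ge0_integral_split_itvcy _ s)//; last exact: ltW.
  have -> : (\int[mu]_(x in `[s, +oo[) (x ^+ 2 * normal_pdf 0 s x)%:E =
      c + \int[mu]_(x in `[s, +oo[) (s ^+ 2 * normal_pdf 0 s x)%:E)%E.
    rewrite -h2 -ge0_integralD//=.
    - by apply: eq_integral => x _; rewrite -EFinD subrK.
    - move=> x; rewrite in_itv/= andbT => sx.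
      rewrite lee_fin -mulrBl mulr_ge0// subr_ge0 lerXn2r ?nnegrE ?(ltW s0)//.
      exact: le_trans (ltW s0) sx.
    - exact/measurable_EFinP/measurable_funTS.
    - by move=> x _; rewrite lee_fin.
    - exact/measurable_EFinP/measurable_funTS.
  have -> : (\int[mu]_(x in `[0%R, s]) (s ^+ 2 * normal_pdf 0 s x)%:E =
      \int[mu]_(x in `[0%R, s]) (x ^+ 2 * normal_pdf 0 s x)%:E + c)%E.
    rewrite -h1 -ge0_integralD//=.
    - by apply: eq_integral => x _; rewrite -EFinD opprB addrC subrK.
    - by move=> x _; rewrite lee_fin.
    - exact/measurable_EFinP/measurable_funTS.
    - move=> x; rewrite in_itv/= => /andP[x0 xs].
      by rewrite lee_fin opprB -mulrBl mulr_ge0// subr_ge0 lerXn2r ?nnegrE ?(ltW s0).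
    - exact/measurable_EFinP/measurable_funTS.
  by rewrite addeA.
(* Both integrands are even, so the equality on the half-line extends to the line, where s^2 f has
   integral s^2. *)
rewrite ge0_symfun_integralT//; last by move=> x /=; rewrite sqrrN fN.
rewrite -set_itvcy half set_itvcy -ge0_symfun_integralT//; last by move=> x /=; rewrite fN.
under eq_integral do rewrite EFinM.
rewrite ge0_integralZl//.
- by rewrite integral_normal_pdf mule1.
- exact/measurable_EFinP.
- by move=> x _; rewrite lee_fin.
- by rewrite lee_fin sqr_ge0.
Qed.

Lemma normal_prob_second_moment (s : R) : 0 < s ->
  (\int[normal_prob 0 s]_x (x ^+ 2)%:E = (s ^+ 2)%:E)%E.
Proof.
move=> s0; rewrite ge0_integral_normal_prob.
- exact: normal_pdf_second_moment.
- by apply/measurable_EFinP; exact: measurable_funX.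
- by move=> x; rewrite lee_fin sqr_ge0.
Qed.

End SecondMoment.


Section CenteredNormal.
Context {R : realType}.

(* The library declares [normal_prob] over [measurableTypeR R], whose display
   differs from that of the canonical measurable structure of [R]. *)
Definition centered_normal (s : R) : probability R R :=
  image_prob (normal_prob 0 s) (idfun : measurableTypeR R -> R)
    (@measurable_id _ _ _).

Lemma ge0_integral_centered_normal (s : R) (f : R -> \bar R) :
  measurable_fun [set: R] f -> (forall x, 0 <= f x)%E ->
  (\int[centered_normal s]_x f x = \int[normal_prob 0 s]_x f x)%E.
Proof. by move=> mf f0; rewrite ge0_integral_image_prob. Qed.

End CenteredNormal.

(** * Product laws on tuples *)

Section ProductLaw.
Context {d : measure_display} {T : measurableType d} {R : realType}.

Definition box n (A : 'I_n -> set T) : set (n.-tuple T) :=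
  [set t | forall i, A i (tnth t i)].

Lemma measurable_box n (A : 'I_n -> set T) :
  (forall i, measurable (A i)) -> measurable (box n A).
Proof.
move=> mA.
have -> : box n A = \bigcap_(i in [set: 'I_n]) ((fun t => tnth t i) @^-1` A i).
  by apply/seteqP; split => t /= h; [move=> i _|move=> i]; exact: h.
apply: fin_bigcap_measurable => [|i _]; first exact: finite_finset.
by rewrite -[X in measurable X]setTI; exact: measurable_tnth.
Qed.

(** Boxes are stable under intersection and generate the product sigma-algebra: a cylinder over one
    coordinate is a box whose other sides are full. *)
Lemma eq_measure_box n (m1 m2 : {measure set (n.-tuple T) -> \bar R}) :
  (m1 setT < +oo)%E ->
  (forall A, (forall i, measurable (A i)) -> m1 (box n A) = m2 (box n A)) ->
  forall N, measurable N -> m1 N = m2 N.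
Proof.
move=> m1oo m12 N mN.
pose B : set (set (n.-tuple T)) :=
  [set box n A | A in [set A | forall i, measurable (A i)]].
have boxT : box n (fun=> setT) = setT by apply/seteqP; split.
apply: (measure_unique B (fun=> setT)) => //.
- rewrite eqEsubset; split.
    apply: smallest_sub; first exact: smallest_sigma_algebra.
    rewrite -bigcup_seq/= => _ [i _ [X mX <-]]; apply: sub_sigma_algebra.
    exists (fun j => if j == i then X else setT) => /=.
      by move=> j; case: ifP.
    rewrite setTI; apply/seteqP; split => t /=; first by move/(_ i); rewrite eqxx.
    by move=> Xt j; case: eqP => // ->.
  apply: smallest_sub; first exact: sigma_algebra_measurable.
  by move=> _ [A mA <-]; exact: measurable_box.
- move=> _ _ [A1 mA1 <-] [A2 mA2 <-]; exists (fun i => A1 i `&` A2 i).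
    by move=> i; exact: measurableI.
  apply/seteqP; split => t /=; first by move=> h; split => i; case: (h i).
  by move=> [h1 h2] i; split.
- by move=> _; exists (fun=> setT).
- by apply/seteqP; split => // t _; exists 0%N.
- by move=> _ [A mA <-]; exact: m12.
Qed.

(** Characterizing the law by boxes matches the form in which mutual independence is given;
    [product_lawS] recovers the iterated product. *)
Definition product_law n (mu : 'I_n -> probability T R)
    (lam : probability (n.-tuple T) R) : Prop :=
  forall A, (forall i, measurable (A i)) ->
    lam (box n A) = (\prod_(i < n) mu i (A i))%E.

Definition tail_law n (lam : probability (n.+1.-tuple T) R) :
    probability (n.-tuple T) R :=
  image_prob lam (fun t : n.+1.-tuple T => [tuple of behead t])
    (@measurable_behead _ T n).

Definition tuple_cons n (x : T * n.-tuple T) : n.+1.-tuple T :=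
  [tuple of x.1 :: x.2].

Lemma measurable_tuple_cons n :
  measurable_fun [set: T * n.-tuple T] (tuple_cons n).
Proof. exact: measurable_cons. Qed.

Lemma product_law_tail n (mu : 'I_n.+1 -> probability T R)
    (lam : probability (n.+1.-tuple T) R) :
  product_law n.+1 mu lam ->
  product_law n (fun i => mu (lift ord0 i)) (tail_law n lam).
Proof.
move=> h A mA; rewrite image_probE.
(* The first side is the whole space and contributes a factor 1. *)
pose A' (i : 'I_n.+1) := if unlift ord0 i is Some j then A j else setT.
have -> : (fun t : n.+1.-tuple T => [tuple of behead t]) @^-1` box n A =
          box n.+1 A'.
  apply/seteqP; split => t /= ht.
    move=> i; rewrite /A'; case: unliftP => [j ->|//].
    by have := ht j; rewrite [t in _ -> A j (tnth t _)]tuple_eta tnthS.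
  move=> j; have := ht (lift ord0 j); rewrite /A' liftK.
  by rewrite [t in A j (tnth t _) -> _]tuple_eta tnthS.
rewrite h; last by move=> i; rewrite /A'; case: unlift.
rewrite big_ord_recl /A' unlift_none probability_setT mul1e.
by apply: eq_bigr => i _; rewrite liftK.
Qed.

Lemma product_lawS n (mu : 'I_n.+1 -> probability T R)
    (lam : probability (n.+1.-tuple T) R) (N : set (n.+1.-tuple T)) :
  product_law n.+1 mu lam -> measurable N ->
  lam N = (mu ord0 \x tail_law n lam)%E (tuple_cons n @^-1` N).
Proof.
move=> h mN.
pose m := image_measure (mu ord0 \x tail_law n lam)%E _ (measurable_tuple_cons n).
change (lam N = m N); apply: eq_measure_box => //.
  exact: (le_lt_trans (probability_le1 lam measurableT) (ltry 1)).
move=> A mA; apply: etrans (h A mA) _; rewrite big_ord_recl.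
rewrite -(product_law_tail _ _ _ h (fun i => A (lift ord0 i)))//.
rewrite -product_measure1E//; last exact: measurable_box.
rewrite /m /= /pushforward; congr (_ _); apply/seteqP; split => -[x t] /=.
  move=> [Ax At] i; case: (unliftP ord0 i) => [j ->|->] //=.
  by rewrite /tuple_cons tnthS; exact: At.
move=> At; split; first exact: (At ord0).
by move=> j; have := At (lift ord0 j); rewrite /tuple_cons tnthS.
Qed.

(** Induction by Fubini: if N is null, the sections of N are null for the tail law outside a
    [mu ord0]-null set of first coordinates. That set is also [mu' ord0]-null, and the induction
    hypothesis transfers the nullity of each remaining section. *)
Lemma product_law_dominates n (mu mu' : 'I_n -> probability T R)
    (lam lam' : probability (n.-tuple T) R) :
  product_law n mu lam -> product_law n mu' lam' ->
  (forall i A, measurable A -> mu i A = 0%E -> mu' i A = 0%E) ->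
  forall N, measurable N -> lam N = 0%E -> lam' N = 0%E.
Proof.
elim: n => [|n IH] in mu mu' lam lam' *.
  move=> _ _ _ N mN.
  (* There is only one empty tuple, so N is empty or everything. *)
  have [->|/set0P[t Nt]] := eqVneq N set0; first by rewrite measure0.
  have -> : N = setT by apply/seteqP; split => // u _; rewrite (tuple0 u) -(tuple0 t).
  by rewrite probability_setT => /eqP; rewrite onee_eq0.
move=> h h' dom N mN.
have mcN : measurable (tuple_cons n @^-1` N).
  by rewrite -[X in measurable X]setTI; exact: measurable_tuple_cons.
rewrite (product_lawS _ _ _ _ h mN) (product_lawS _ _ _ _ h' mN).
rewrite /product_measure1 => l0.
set C := tuple_cons n @^-1` N in mcN l0 *.
have mf (l : probability (n.-tuple T) R) :
    measurable_fun setT (fun x => (l \o xsection C) x).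
  exact: measurable_fun_xsection.
have : (\int[mu ord0]_x `|(tail_law n lam \o xsection C) x| = 0)%E.
  by rewrite -[RHS]l0; apply: eq_integral => x _; rewrite gee0_abs.
move/(ae_eq_integral_abs _ measurableT (mf _)) => [Z [mZ Z0 CZ]].
rewrite (ae_eq_integral (cst 0%E))// ?integral0//.
exists Z; split => //; first exact: dom.
move=> x /= nx; apply: CZ => /= hx; apply: nx => _; move: (hx I).
apply: (IH _ _ _ _ (product_law_tail _ _ _ h) (product_law_tail _ _ _ h')) => //.
- by move=> i A; exact: dom.
- exact: measurable_xsection.
Qed.

End ProductLaw.

(** * Signal plus noise *)

Section Independence.
Context {d d1 d2 : measure_display} {T : measurableType d}
  {T1 : measurableType d1} {T2 : measurableType d2} {R : realType}.
Variables (P : probability T R) (X : T -> T1) (Y : T -> T2).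
Variables (mu : probability T1 R) (nu : probability T2 R).
Hypotheses (mX : measurable_fun [set: T] X) (mY : measurable_fun [set: T] Y).
Hypothesis PXY : forall A B, measurable A -> measurable B ->
  P (X @^-1` A `&` Y @^-1` B) = (mu A * nu B)%E.

Let mXY : measurable_fun [set: T] (fun x => (X x, Y x)).
Proof. exact: measurable_fun_pair. Qed.

Lemma independent_product_measure (N : set (T1 * T2)) : measurable N ->
  P ((fun x => (X x, Y x)) @^-1` N) = (mu \x nu)%E N.
Proof.
move=> mN; apply/esym.
have h := @product_measure_unique _ _ _ _ _ mu nu (image_measure P _ mXY).
apply: (h _ N mN) => A B mA mB.
exact: PXY.
Qed.

Lemma ge0_integral_independent (F : T1 * T2 -> \bar R) :
  measurable_fun [set: T1 * T2] F -> (forall y, 0 <= F y)%E ->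
  (\int[P]_x F (X x, Y x) = \int[mu]_a \int[nu]_b F (a, b))%E.
Proof.
move=> mF F0.
rewrite -[LHS](ge0_integral_image_prob P _ mXY F mF F0) -fubini_tonelli1//.
by apply: eq_measure_integral => N mN _; exact: independent_product_measure.
Qed.

End Independence.

Section ProcessTuple.
Context {d : measure_display} {T : measurableType d} {R : realType}.
Context {I : eqType}.
Variables (P : probability T R) (D : set I).
Implicit Types z e : I -> {mfun T >-> R}.

Definition sample z n (t : n.-tuple I) (x : T) : n.-tuple R :=
  [tuple z (tnth t i) x | i < n].

Lemma measurable_sample z n (t : n.-tuple I) :
  measurable_fun [set: T] (sample z n t).
Proof.
apply/measurable_fun_tnthP => i.
rewrite (_ : _ \o _ = z (tnth t i)); first exact: measurable_funPT.
by apply/funext => x /=; rewrite tnth_mktuple.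
Qed.

(** Viewing T with the sigma-algebra of the process as a measurable type of its own lets the closure
    properties of measurable functions prove membership in that sigma-algebra. *)
Lemma process_sigma_algebra_preimage z d' (T' : measurableType d')
    (f : T -> T') (A : set T') :
  measurable_fun [set: g_sigma_algebraType
    (\bigcup_(s in D) preimage_set_system [set: T] (z s) measurable)]
    (f : g_sigma_algebraType _ -> T') ->
  measurable A -> process_sigma_algebra D z (f @^-1` A).
Proof. by move=> mf mA; have := mf measurableT A mA; rewrite setTI. Qed.

Lemma process_sigma_algebra_measurable z s : D s ->
  measurable_fun [set: g_sigma_algebraType
    (\bigcup_(s in D) preimage_set_system [set: T] (z s) measurable)]
    (z s : g_sigma_algebraType _ -> R).
Proof.
move=> Ds _ Y mY; rewrite setTI; apply: sub_sigma_algebra.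
by exists s => //; exists Y => //; rewrite setTI.
Qed.

Lemma process_sigma_algebra_sample z n (t : n.-tuple I) (A : set (n.-tuple R)) :
  (forall i, D (tnth t i)) -> measurable A ->
  process_sigma_algebra D z (sample z n t @^-1` A).
Proof.
move=> Dt; apply: process_sigma_algebra_preimage.
apply/measurable_fun_tnthP => i.
rewrite (_ : _ \o _ = z (tnth t i)); first exact: process_sigma_algebra_measurable.
by apply/funext => x /=; rewrite tnth_mktuple.
Qed.

Lemma white_noise_product_law e tau2 n (t : n.-tuple I) :
  gaussian_white_noise P D e tau2 -> uniq t -> (forall i, D (tnth t i)) ->
  product_law n (fun=> centered_normal (Num.sqrt tau2))
    (image_prob P (sample e n t) (measurable_sample e n t)).
Proof.
move=> [ind law] ut Dt A mA; rewrite image_probE.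
have -> : sample e n t @^-1` box n A =
    \bigcap_(i in [set: 'I_n]) (e (tnth t i) @^-1` A i).
  apply/seteqP; split => x /= h.
    by move=> i _; have := h i; rewrite tnth_mktuple.
  by move=> i; rewrite tnth_mktuple; exact: h.
by rewrite ind//; apply: eq_bigr => i _; exact: law.
Qed.

End ProcessTuple.

Section TupleSum.
Context {R : realType}.

Definition tuple_add n (ab : n.-tuple R * n.-tuple R) : n.-tuple R :=
  [tuple tnth ab.1 i + tnth ab.2 i | i < n].

Lemma measurable_tuple_add n :
  measurable_fun [set: n.-tuple R * n.-tuple R] (tuple_add n).
Proof.
apply/measurable_fun_tnthP => i.
rewrite (_ : _ \o _ = (fun ab => tnth ab.1 i + tnth ab.2 i)).
  by apply: measurable_funD; apply: (measurableT_comp (measurable_tnth i)).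
by apply/funext => x /=; rewrite tnth_mktuple.
Qed.

Lemma measurable_tuple_addl n (a : n.-tuple R) :
  measurable_fun [set: n.-tuple R] (fun b => tuple_add n (a, b)).
Proof.
exact: (measurableT_comp (measurable_tuple_add n) (pair1_measurable a)).
Qed.

Lemma measurable_shift (a : R) : measurable_fun [set: R] (fun x : R => a + x).
Proof. exact: measurable_funD. Qed.

Lemma product_law_shift n (mu : 'I_n -> probability R R)
    (lam : probability (n.-tuple R) R) (a : n.-tuple R) :
  product_law n mu lam ->
  product_law n (fun i => image_prob (mu i) _ (measurable_shift (tnth a i)))
    (image_prob lam _ (measurable_tuple_addl n a)).
Proof.
move=> h A mA; rewrite image_probE.
have -> : (fun b => tuple_add n (a, b)) @^-1` box n A =
    box n (fun i => (fun x => tnth a i + x) @^-1` A i).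
  by apply/seteqP; split => b /= hb i; have := hb i; rewrite tnth_mktuple.
rewrite h// => i.
by rewrite -[X in measurable X]setTI; exact: measurable_shift.
Qed.

End TupleSum.

Section DataLaw.
Context {R : realType} {p : nat} {D : set 'rV[R]_p}.

Lemma dataE d (T : measurableType d) (z e : 'rV[R]_p -> {mfun T >-> R}) n
    (s : n.-tuple 'rV[R]_p) (x : T) :
  data z e s x = tuple_add n (sample z n s x, sample e n s x).
Proof.
by apply: eq_from_tnth => i; rewrite !tnth_mktuple.
Qed.

Lemma measurable_data d (T : measurableType d)
    (z e : 'rV[R]_p -> {mfun T >-> R}) n (s : n.-tuple 'rV[R]_p) :
  measurable_fun [set: T] (data z e s).
Proof.
rewrite (_ : data z e s = tuple_add n \o (fun x => (sample z n s x, sample e n s x))).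
  apply: (measurableT_comp (measurable_tuple_add n)).
  by apply: measurable_fun_pair; exact: measurable_sample.
by apply/funext => x; rewrite dataE.
Qed.

(* Conditionally on the latent process, the data are a shifted sample of the
   noise, whose law is equivalent to Lebesgue measure whatever the shift: the
   covariance of the latent process plays no role. *)
Lemma data_null_dominates d d' (T : measurableType d) (T' : measurableType d')
    (P : probability T R) (P' : probability T' R)
    (z e : 'rV[R]_p -> {mfun T >-> R}) (z' e' : 'rV[R]_p -> {mfun T' >-> R})
    (tau2 tau2' : R) n (s : n.-tuple 'rV[R]_p) (N : set (n.-tuple R)) :
  0 < tau2 -> 0 < tau2' ->
  gaussian_white_noise P D e tau2 -> independent_processes P D z e ->
  gaussian_white_noise P' D e' tau2' -> independent_processes P' D z' e' ->
  uniq s -> (forall i, D (tnth s i)) -> measurable N ->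
  P (data z e s @^-1` N) = 0%E -> P' (data z' e' s @^-1` N) = 0%E.
Proof.
move=> t0 t0' wn ind wn' ind' us Ds mN.
set S := tuple_add n @^-1` N.
have mS : measurable S.
  by rewrite -[X in measurable X]setTI; exact: measurable_tuple_add.
have joint d3 (T3 : measurableType d3) (P3 : probability T3 R) z3 e3 :
    independent_processes P3 D z3 e3 ->
    P3 (data z3 e3 s @^-1` N) =
    (\int[image_prob P3 (sample z3 n s) (measurable_sample z3 n s)]_a
      image_prob (image_prob P3 (sample e3 n s) (measurable_sample e3 n s)) _
        (measurable_tuple_addl n a) N)%E.
  move=> ind3.
  have -> : data z3 e3 s @^-1` N =
      (fun x => (sample z3 n s x, sample e3 n s x)) @^-1` S.
    by apply/seteqP; split => x /=; rewrite dataE.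
  rewrite (independent_product_measure P3 (sample z3 n s) (sample e3 n s)
    (image_prob P3 (sample z3 n s) (measurable_sample z3 n s))
    (image_prob P3 (sample e3 n s) (measurable_sample e3 n s)))//.
  - rewrite /product_measure1; apply: eq_integral => a _ /=.
    by congr (P3 _); apply/seteqP; split => x /=; rewrite /xsection/= inE.
  - exact: measurable_sample.
  - exact: measurable_sample.
  - by move=> A B mA mB; apply: ind3; exact: process_sigma_algebra_sample.
rewrite (joint _ _ _ _ _ ind) (joint _ _ _ _ _ ind') => P0.
set zeta := image_prob P (sample z n s) (measurable_sample z n s) in P0.
set lam := image_prob P (sample e n s) (measurable_sample e n s) in P0.
(* A nonnegative function with zero integral under a probability vanishes somewhere. One such shift
   a suffices: the shifted noise laws dominate one another, so N is then null for every shift of the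
   other noise. *)
have [a la0] : exists a, image_prob lam _ (measurable_tuple_addl n a) N = 0%E.
  apply: contrapT => /forallNP h.
  have mf : measurable_fun setT
      (fun a => image_prob lam _ (measurable_tuple_addl n a) N).
    have := measurable_fun_xsection lam mS.
    apply: eq_measurable_fun => a _ /=; congr (P _).
    by apply/seteqP; split => x /=; rewrite /xsection/= inE.
  have : (\int[zeta]_a `|image_prob lam _ (measurable_tuple_addl n a) N| = 0)%E.
    by rewrite -[RHS]P0; apply: eq_integral => x _; rewrite gee0_abs.
  move/(ae_eq_integral_abs zeta measurableT mf) => [Z [mZ Z0 CZ]].
  have ZT : Z = setT.
    by apply/seteqP; split => // x _; apply: CZ => /= /(_ I); exact: h.
  rewrite ZT in Z0; have /eqP := etrans (esym (probability_setT zeta)) Z0.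
  by rewrite onee_eq0.
apply: integral0_eq => a' _.
apply: (product_law_dominates n _ _ _ _
  (product_law_shift n _ _ a (white_noise_product_law P D e tau2 n s wn us Ds))
  (product_law_shift n _ _ a' (white_noise_product_law P' D e' tau2' n s wn' us Ds))
  _ N mN la0).
have sd0 : Num.sqrt tau2 != 0 by rewrite gt_eqF// sqrtr_gt0.
move=> i A mA A0.
exact: (normal_null_shift (tnth a i) (tnth a' i) _ (Num.sqrt tau2') A sd0 mA A0).
Qed.

End DataLaw.

Section NoiseIndependence.
Context {R : realType} {p : nat} {D : set 'rV[R]_p}.
Context {d : measure_display} {T : measurableType d}.
Variables (P : probability T R) (z e : 'rV[R]_p -> {mfun T >-> R}) (tau2 : R).
Hypotheses (wn : gaussian_white_noise P D e tau2)
  (ind : independent_processes P D z e) (tau2_gt0 : 0 < tau2).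
Variables (n : nat) (s : n.-tuple 'rV[R]_p) (s0 : 'rV[R]_p).
Hypotheses (us : uniq s) (s0s : s0 \notin s) (Ds : forall i, D (tnth s i))
  (Ds0 : D s0).

Let sd := Num.sqrt tau2.
Let sd0 : sd != 0. Proof. by rewrite gt_eqF// sqrtr_gt0. Qed.

(** As s_0 differs from the observed locations, the noise at s_0 and at the data locations is a
    single product sample on n + 1 distinct points, independent of the latent process. *)
Lemma noise_data_independent (A : set R) (B : set (n.-tuple R)) :
  measurable A -> measurable B ->
  P (e s0 @^-1` A `&` data z e s @^-1` B) =
  (centered_normal sd A * P (data z e s @^-1` B))%E.
Proof.
move=> mA mB.
pose ts : n.+1.-tuple 'rV[R]_p := [tuple of s0 :: s].
have uts : uniq ts by rewrite /= s0s us.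
have Dts i : D (tnth ts i).
  by case: (unliftP ord0 i) => [j ->|->]; rewrite ?tnthS//.
pose zeta := image_prob P (sample z n s) (measurable_sample z n s).
pose lam := image_prob P (sample e n.+1 ts) (measurable_sample e n.+1 ts).
have plam : product_law n.+1 (fun=> centered_normal sd) lam.
  exact: (white_noise_product_law P D e tau2 n.+1 ts wn uts Dts).
(* This factor is free of A', so taking the full set for A' will identify it as the probability that
   the data lie in B. *)
pose c := (\int[zeta]_a tail_law n lam ((fun u => tuple_add n (a, u)) @^-1` B))%E.
have key A' : measurable A' -> P (e s0 @^-1` A' `&` data z e s @^-1` B) =
    (centered_normal sd A' * c)%E.
  move=> mA'.
  pose S : set (n.-tuple R * n.+1.-tuple R) :=
    (fun at_ : n.-tuple R * n.+1.-tuple R => thead at_.2) @^-1` A' `&`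
    (fun at_ : n.-tuple R * n.+1.-tuple R => tuple_add n (at_.1, [tuple of behead at_.2])) @^-1` B.
  have mS : measurable S.
    rewrite /S; apply: measurableI.
      rewrite -[X in measurable X]setTI.
      exact: (measurableT_comp (measurable_tnth ord0) measurable_snd).
    rewrite -[X in measurable X]setTI.
    have m1 : measurable_fun [set: n.-tuple R * n.+1.-tuple R]
        (fun at_ : n.-tuple R * n.+1.-tuple R => tuple_add n (at_.1, [tuple of behead at_.2])).
      apply: (measurableT_comp (measurable_tuple_add n)).
      apply: measurable_fun_pair => //.
      exact: (measurableT_comp (@measurable_behead _ R n) measurable_snd).
    exact: m1.
  have -> : e s0 @^-1` A' `&` data z e s @^-1` B =
      (fun x => (sample z n s x, sample e n.+1 ts x)) @^-1` S.
    have e1 x : thead (sample e n.+1 ts x) = e s0 x by rewrite /thead tnth_mktuple.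
    have e2 x : [tuple of behead (sample e n.+1 ts x)] = sample e n s x.
      apply: eq_from_tnth => i; rewrite tnth_behead !tnth_mktuple.
      congr (e _ x); rewrite (_ : inord i.+1 = lift ord0 i) ?tnthS//.
      by apply/val_inj; rewrite /= inordK ?ltnS.
    have e3 x : S (sample z n s x, sample e n.+1 ts x) =
        (A' (e s0 x) /\ B (data z e s x)) by rewrite dataE -e1 -e2.
    by apply/seteqP; split => x /=; rewrite e3.
  rewrite (independent_product_measure P (sample z n s) (sample e n.+1 ts)
    zeta lam)//.
  - rewrite /product_measure1 /c -ge0_integralZl//.
    + apply: eq_integral => a _; rewrite [LHS]/comp.
      rewrite (product_lawS _ _ _ _ plam); last exact: measurable_xsection.
      transitivity ((centered_normal sd \x tail_law n lam)%E
          (A' `*` ((fun u => tuple_add n (a, u)) @^-1` B))); last first.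
        apply: product_measure1E => //.
        by rewrite -[X in measurable X]setTI; exact: measurable_tuple_addl.
      * congr (_ _); apply/seteqP; split => -[x u] /=.
          rewrite /xsection/= inE /S/= theadE => -[A'x Bu]; split => //.
          by move: Bu; congr (B (tuple_add n (a, _))); exact: val_inj.
        rewrite /xsection/= inE /S/= theadE => -[A'x Bu]; split => //.
        by move: Bu; congr (B (tuple_add n (a, _))); exact: val_inj.
    + have mSB : measurable (tuple_add n @^-1` B).
        by rewrite -[X in measurable X]setTI; exact: measurable_tuple_add.
      have := measurable_fun_xsection (tail_law n lam) mSB.
      apply: eq_measurable_fun => a _ /=; congr (P _).
      by apply/seteqP; split => x /=; rewrite /xsection/= inE.
  - exact: measurable_sample.
  - exact: measurable_sample.
  - by move=> A1 A2 mA1 mA2; apply: ind; exact: process_sigma_algebra_sample.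
rewrite key//; congr (_ * _)%E.
have := key setT measurableT.
by rewrite preimage_setT setTI probability_setT mul1e => ->.
Qed.

Lemma integral_noise_data (g : R -> \bar R) (B : set (n.-tuple R)) :
  measurable_fun [set: R] g -> (forall u, 0 <= g u)%E -> measurable B ->
  (\int[P]_x (g (e s0 x) * (\1_B (data z e s x))%:E) =
   \int[centered_normal sd]_u g u * P (data z e s @^-1` B))%E.
Proof.
move=> mg g0 mB.
pose nu := image_prob P (data z e s) (measurable_data _ _ z e n s).
have m1B : measurable_fun [set: n.-tuple R] (fun y => (\1_B y)%:E : \bar R).
  by apply/measurable_EFinP; exact: measurable_indic.
rewrite (ge0_integral_independent P (e s0) (data z e s) (centered_normal sd) nu
  _ _ _ (fun ay => g ay.1 * (\1_B ay.2)%:E)%E).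
- rewrite -ge0_integralZr//.
  apply: eq_integral => a _ /=.
  by rewrite ge0_integralZl// integral_indic// setIT.
- exact: measurable_funPT.
- exact: measurable_data.
- by move=> A C mA mC; exact: noise_data_independent.
- by apply: emeasurable_funM; [exact: (measurableT_comp mg)|
    exact: (measurableT_comp m1B)].
- by move=> y; rewrite mule_ge0.
Qed.

Definition window (i : 'I_n) (K : R) : set (n.-tuple R) :=
  (fun y => tnth y i) @^-1` `[- K, K].

Lemma measurable_window (i : 'I_n) (K : R) : measurable (window i K).
Proof. by rewrite -[X in measurable X]setTI; exact: measurable_tnth. Qed.

(* Given the latent process, the probability that the i-th observation falls in
   [-K, K] is at most 2K times the maximum of the noise density. *)
Lemma integral_latent_window_le (g : R -> \bar R) (i : 'I_n) (K : R) :
  0 <= K -> measurable_fun [set: R] g -> (forall u, 0 <= g u)%E ->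
  (\int[P]_x (g (z s0 x) * (\1_(window i K) (data z e s x))%:E) <=
   (normal_peak sd * (2 * K))%:E * \int[P]_x g (z s0 x))%E.
Proof.
move=> K0 mg g0.
pose si := tnth s i.
(* The latent values at s_0 and s_i are dependent and stay together; only the noise at s_i is
   integrated out. *)
have mZ : measurable_fun [set: T] (fun x => (z s0 x, z si x)).
  exact: measurable_fun_pair.
pose zeta := image_prob P _ mZ.
pose F (au : R * R * R) : \bar R := (g au.1.1 * (\1_`[- K, K] (au.1.2 + au.2))%:E)%E.
have m1K : measurable_fun [set: R] (fun y => (\1_`[- K, K] y)%:E : \bar R).
  by apply/measurable_EFinP; exact: measurable_indic.
have mF : measurable_fun [set: R * R * R] F.
  apply: emeasurable_funM.
    exact: (measurableT_comp mg (measurableT_comp measurable_fst measurable_fst)).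
  apply: (measurableT_comp m1K); apply: measurable_funD => //.
  exact: (measurableT_comp measurable_snd measurable_fst).
have F0 y : (0 <= F y)%E by rewrite mule_ge0.
rewrite (eq_integral (fun x => F ((z s0 x, z si x), e si x))); last first.
  move=> x _; congr (_ * _%:E)%E; rewrite !indicE; congr ((_ : bool)%:R).
  by apply/idP/idP; rewrite !inE /window/= tnth_mktuple.
rewrite (ge0_integral_independent P (fun x => (z s0 x, z si x)) (e si) zeta
  (centered_normal sd))//.
- rewrite -(ge0_integral_image_prob P _ mZ (fun a => g a.1))//; last first.
    exact: (measurableT_comp mg).
  rewrite -ge0_integralZl//=; last 2 first.
  + exact: (measurableT_comp mg).
  + by rewrite lee_fin !mulr_ge0// normal_peak_ge0.
  apply: ge0_le_integral => //.
  + by move=> a _; exact: integral_ge0.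
  + exact: measurable_fun_fubini_tonelli_F.
  + by apply: emeasurable_funM => //; exact: (measurableT_comp mg).
  move=> [a b] _.
  have hI : (\int[centered_normal sd]_u (\1_((fun u => b + u) @^-1` `[- K, K]) u)%:E <=
      (normal_peak sd * (2 * K))%:E)%E.
    have -> : (fun u => b + u) @^-1` `[- K, K] = `[- K - b, K - b]%classic.
      by apply/seteqP; split => x /=; rewrite !in_itv/= => /andP[? ?]; apply/andP; split; lra.
    rewrite integral_indic// setIT.
    apply: le_trans (normal_prob_itv_le 0 sd (- K - b) (K - b) sd0 _) _; first by lra.
    by rewrite lee_fin ler_wpM2l ?normal_peak_ge0//; lra.
  rewrite /F/= ge0_integralZl//; last first.
    by apply: (measurableT_comp m1K); exact: measurable_shift.
  by rewrite muleC lee_wpmul2r//; exact: hI.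
- move=> A B mA mB; rewrite ind//.
  + by rewrite (_ : P (e si @^-1` B) = centered_normal sd B)//; exact: (wn.2 si (Ds i) B mB).
  + apply: process_sigma_algebra_preimage => //.
    apply: measurable_fun_pair; first exact: process_sigma_algebra_measurable.
    exact: (process_sigma_algebra_measurable _ _ _ (Ds i)).
  + apply: process_sigma_algebra_preimage => //.
    exact: (process_sigma_algebra_measurable _ _ _ (Ds i)).
Qed.

End NoiseIndependence.

(** * Moment bounds uniform in the partial sill *)

Section Moments.
Context {d : measure_display} {T : measurableType d} {R : realType}.
Variable P : probability T R.

(** Integrate |f| <= f^2 / (2r) + r / 2, which is (|f| - r)^2 >= 0; each of the two terms
    contributes r / 2. *)
Lemma abs_moment_le (f : T -> R) (r : R) : 0 < r ->
  measurable_fun [set: T] f ->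
  (\int[P]_x (f x ^+ 2)%:E = (r ^+ 2)%:E)%E -> (\int[P]_x `|f x|%:E <= r%:E)%E.
Proof.
move=> r0 mf f2.
have mf2 : measurable_fun [set: T] (fun x => (f x ^+ 2)%:E).
  by apply/measurable_EFinP; exact: measurable_funX.
have c0 : 0 <= (2 * r)^-1 by rewrite invr_ge0 mulr_ge0// ltW.
apply: (@le_trans _ _ (\int[P]_x ((2 * r)^-1%:E * (f x ^+ 2)%:E + (r / 2)%:E))%E).
  apply: ge0_le_integral => //.
  - by apply/measurable_EFinP; exact: measurableT_comp.
  - by apply: emeasurable_funD => //; exact: measurable_funeM.
  - move=> x _; rewrite -EFinM -EFinD lee_fin -subr_ge0.
    have -> : (2 * r)^-1 * f x ^+ 2 + r / 2 - `|f x| = (2 * r)^-1 * (`|f x| - r) ^+ 2.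
      by rewrite -(real_normK (num_real (f x))); field; lra.
    by rewrite mulr_ge0// sqr_ge0.
rewrite ge0_integralD//; last 3 first.
- by move=> x _; rewrite mule_ge0// lee_fin sqr_ge0.
- exact: measurable_funeM.
- by move=> x _; rewrite lee_fin divr_ge0// ltW.
rewrite ge0_integralZl//; last by move=> x _; rewrite lee_fin sqr_ge0.
rewrite f2 integral_cst//= probability_setT mule1 -EFinM -EFinD lee_fin.
rewrite le_eqVlt; apply/orP; left; apply/eqP; field; lra.
Qed.

End Moments.

Section GaussianMoments.
Context {R : realType}.

Lemma centered_normal_abs_le (s : R) : 0 < s ->
  (\int[centered_normal s]_u `|u|%:E <= s%:E)%E.
Proof.
move=> s0; apply: (abs_moment_le _ idfun) => //.
  exact: measurable_id.
apply: etrans (ge0_integral_centered_normal s (fun u => (u ^+ 2)%:E) _ _) _.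
- by apply/measurable_EFinP; exact: measurable_funX.
- by move=> x; rewrite lee_fin sqr_ge0.
- exact: normal_prob_second_moment.
Qed.

Lemma centered_normal_sym (s : R) (f : R -> \bar R) : 0 < s ->
  measurable_fun [set: R] f -> (forall x, 0 <= f x)%E ->
  (\int[centered_normal s]_u f (- u)%R = \int[centered_normal s]_u f u)%E.
Proof.
move=> s0 mf f0; rewrite !ge0_integral_centered_normal//.
  by apply: normal_prob_sym => //; rewrite gt_eqF.
by apply: (measurableT_comp mf); exact: oppr_measurable.
Qed.

(** The right-hand side is free of s: this scale invariance removes the partial sill from the window
    bounds. *)
Lemma mul_normal_peak (s : R) : 0 < s ->
  s * normal_peak s = (Num.sqrt (pi *+ 2))^-1.
Proof.
move=> s0; rewrite /normal_peak -mulrnAr sqrtrM ?sqr_ge0// sqrtr_sqr gtr0_norm//.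
by rewrite invfM mulrA divff ?mul1r// gt_eqF.
Qed.

End GaussianMoments.

Section MaternWindow.
Context {R : realType} {p : nat} {D : set 'rV[R]_p}.
Context {d : measure_display} {T : measurableType d}.
Variables (P : probability T R) (z e : 'rV[R]_p -> {mfun T >-> R}).

Lemma latent_second_moment (sigma2 phi nu tau2 : R) (s : 'rV[R]_p) :
  matern_model P D z e sigma2 phi nu tau2 -> D s ->
  (\int[P]_x (z s x ^+ 2)%:E = sigma2%:E)%E.
Proof.
move=> [_ Ez cov _ _] Ds; have := cov s s Ds Ds.
rewrite /matern_corr eqxx mulr1 covariance.unlock Ez//= => <-.
rewrite expectation.unlock; apply: eq_integral => x _; congr EFin.
by transitivity ((z s x - 0) * (z s x - 0)) => //; rewrite subr0 expr2.
Qed.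

Variables (v phi nu delta : R) (n : nat) (s : n.-tuple 'rV[R]_p) (s0 : 'rV[R]_p).
Hypotheses (v0 : 0 < v) (delta0 : 0 < delta)
  (mm : matern_model P D z e v phi nu (delta * v)).
Hypotheses (us : uniq s) (s0s : s0 \notin s) (Ds : forall i, D (tnth s i))
  (Ds0 : D s0).

Let sd_gt0 : 0 < Num.sqrt (delta * v). Proof. by rewrite sqrtr_gt0 mulr_gt0. Qed.

(* The bounds of the next two lemmas do not depend on the partial sill v: the
   factor v^(-1/2) of the noise density compensates the scale v^(1/2) of the
   integrand. *)
Lemma latent_window_le (i : 'I_n) (K : R) : 0 <= K ->
  (\int[P]_x (`|z s0 x|%:E * (\1_(window n i K) (data z e s x))%:E) <=
   (2 * K / Num.sqrt delta / Num.sqrt (pi *+ 2))%:E)%E.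
Proof.
move=> K0; have [_ _ _ wn ind] := mm.
have mabs : measurable_fun [set: R] (fun u : R => `|u|%:E : \bar R).
  by apply/measurable_EFinP; exact: normr_measurable.
apply: le_trans (integral_latent_window_le P z e (delta * v) wn ind _ n s s0 Ds Ds0
  (fun u => `|u|%:E) i K K0 mabs _) _ => //; first exact: (mulr_gt0 delta0 v0).
apply: (@le_trans _ _ ((normal_peak (Num.sqrt (delta * v)) * (2 * K))%:E *
    (Num.sqrt v)%:E)%E).
  apply: lee_wpmul2l; first by rewrite lee_fin !mulr_ge0// normal_peak_ge0.
  apply: abs_moment_le; rewrite ?sqrtr_gt0//.
  by rewrite (latent_second_moment _ _ _ _ _ mm)// sqr_sqrtr// ltW.
rewrite -EFinM lee_fin -(mul_normal_peak _ sd_gt0).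
have sv : 0 < Num.sqrt v by rewrite sqrtr_gt0.
have sde : 0 < Num.sqrt delta by rewrite sqrtr_gt0.
have -> : Num.sqrt (delta * v) * normal_peak (Num.sqrt (delta * v)) =
    Num.sqrt delta * Num.sqrt v * normal_peak (Num.sqrt (delta * v)).
  by rewrite -sqrtrM// ltW.
rewrite le_eqVlt; apply/orP; left; apply/eqP; field; lra.
Qed.

Lemma noise_window_le (i : 'I_n) (K : R) : 0 <= K ->
  (\int[P]_x (`|e s0 x|%:E * (\1_(window n i K) (data z e s x))%:E) <=
   (2 * K / Num.sqrt (pi *+ 2))%:E)%E.
Proof.
move=> K0; have [_ _ _ wn ind] := mm.
have mabs : measurable_fun [set: R] (fun u : R => `|u|%:E : \bar R).
  by apply/measurable_EFinP; exact: normr_measurable.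
have dv : 0 < delta * v by exact: mulr_gt0.
rewrite (integral_noise_data P z e (delta * v) wn ind n s s0 us s0s Ds Ds0
  (fun u => `|u|%:E))//; last exact: measurable_window.
have PW : (P (data z e s @^-1` window n i K) <=
    (normal_peak (Num.sqrt (delta * v)) * (2 * K))%:E)%E.
  (* With the constant integrand 1 the latent bound becomes a bound on the probability of the
     window. *)
  have := integral_latent_window_le P z e (delta * v) wn ind dv n s s0 Ds Ds0
    (cst 1%E) i K K0 (measurable_cst _) (fun=> lee01).
  have mDW : measurable (data z e s @^-1` window n i K).
    rewrite -[X in measurable X]setTI; apply: measurable_data => //.
    exact: measurable_window.
  have -> : (\int[P]_x cst 1 (z s0 x) = 1)%E.
    by rewrite integral_cst// mul1e; exact: probability_setT.
  have -> : (\int[P]_x (cst 1 (z s0 x) * (\1_(window n i K) (data z e s x))%:E) =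
      P (data z e s @^-1` window n i K))%E.
    transitivity (\int[P]_x (\1_(data z e s @^-1` window n i K) x)%:E)%E.
      by apply: eq_integral => x _; rewrite mul1e.
    by rewrite integral_indic// setIT.
  by rewrite mule1.
apply: le_trans (lee_pmul _ _ (centered_normal_abs_le _ sd_gt0) PW) _ => //.
  by apply: integral_ge0 => x _; rewrite lee_fin.
by rewrite -EFinM lee_fin mulrA mul_normal_peak// mulrC.
Qed.

End MaternWindow.

(** * Conditional laws *)

Section Disintegration.
Context {d d1 d2 : measure_display} {T : measurableType d}
  {T1 : measurableType d1} {T2 : measurableType d2} {R : realType}.
Variables (P : probability T R) (Y : T -> T1) (X : T -> T2).
Variable k : T1 -> probability T2 R.
Hypotheses (mY : measurable_fun [set: T] Y) (mX : measurable_fun [set: T] X).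
Hypothesis kP : conditional_law P Y X k.

Let mYX : measurable_fun [set: T] (fun x => (Y x, X x)).
Proof. exact: measurable_fun_pair. Qed.

(** The conditional law of the pair (Y, X) given Y = y, namely the product of a Dirac mass at y with
    [k y]. *)
Let K (y : T1) : giry (T1 * T2)%type R :=
  giry_prod (giry_ret y, (k y : subprobability T2 R)).

Let mK : measurable_fun [set: T1] K.
Proof.
apply: (measurableT_comp measurable_giry_prod).
apply: measurable_fun_pair; first exact: measurable_giry_ret.
by apply: measurable_giry_codensity => // B mB; exact: kP.1.
Qed.

Lemma eq_measure_rectangle (m1 m2 : {measure set (T1 * T2) -> \bar R}) :
  (m1 setT < +oo)%E ->
  (forall A B, measurable A -> measurable B -> m1 (A `*` B) = m2 (A `*` B)) ->
  forall N, measurable N -> m1 N = m2 N.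
Proof.
move=> m1oo m12 N mN.
apply: (measure_unique [set A `*` B | A in measurable & B in measurable]
  (fun=> setT)) => //.
- exact: measurable_prod_measurableType.
- move=> _ _ [A mA [B mB <-]] [A' mA' [B' mB' <-]].
  exists (A `&` A'); first exact: measurableI.
  exists (B `&` B'); first exact: measurableI.
  by rewrite setXI.
- by move=> _; exists setT => //; exists setT => //; rewrite setXTT.
- by apply/seteqP; split => // t _; exists 0%N.
- by move=> _ [A mA [B mB <-]]; exact: m12.
Qed.

(** The definition of [conditional_law] says that the joint law and the bind of the law of Y with
    [K] agree on rectangles, hence everywhere; the integration rules of the Giry monad then give the
    iterated integral. *)
Lemma ge0_integral_conditional_law (F : T1 * T2 -> \bar R) :
  measurable_fun [set: T1 * T2] F -> (forall a, 0 <= F a)%E ->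
  (\int[P]_x F (Y x, X x) = \int[P]_x \int[k (Y x)]_u F (Y x, u))%E.
Proof.
move=> mF F0.
pose Q : giry T1 R := (image_prob P Y mY : subprobability T1 R).
rewrite -[LHS](ge0_integral_image_prob P _ mYX F mF F0).
transitivity (giry_int (giry_bind Q mK) F).
  apply: eq_measure_integral => N mN _; apply: eq_measure_rectangle => //.
    exact: (le_lt_trans (probability_le1 (image_prob P _ mYX) measurableT) (ltry 1)).
  move=> A B mA mB.
  have mAB : measurable (A `*` B) by exact: measurableX.
  have mkB : measurable_fun [set: T1] (fun y => k y B) by exact: kP.1.
  have mdA : measurable_fun [set: T1] (fun y => \d_y A : \bar R).
    exact: measurable_fun_dirac.
  transitivity (giry_int (giry_map mK Q) (giry_ev ^~ (A `*` B))); last by [].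
  rewrite giry_int_map//; last exact: measurable_giry_ev.
  transitivity (\int[Q]_y (\d_y A * k y B))%E; last first.
    apply: eq_integral => y _ /=; rewrite /giry_ev /=.
    by apply/esym; exact: product_measure1E.
  have mdk : measurable_fun [set: T1] (fun y => \d_y A * k y B)%E.
    exact: emeasurable_funM.
  have dk0 y : (0 <= \d_y A * k y B)%E by exact: mule_ge0.
  rewrite ge0_integral_image_prob//.
  transitivity (P (X @^-1` B `&` Y @^-1` A)).
    by rewrite setIC.
  rewrite kP.2// [LHS]integral_mkcond; apply: eq_integral => x _.
  rewrite patchE diracE; have [hA|hA] := pselect (A (Y x)).
    by rewrite !mem_set// mul1e.
  by rewrite !memNset// mul0e.
rewrite giry_int_bind// /giry_int ge0_integral_image_prob//; last 2 first.
- have := measurable_giry_int mF F0.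
  by move=> /(measurableT_comp)/(_ mK).
- by move=> y; exact: integral_ge0.
apply: eq_integral => x _.
pose kx : giry T2 R := (k (Y x) : subprobability T2 R).
transitivity (giry_int (giry_prod (giry_ret (Y x), kx)) F); first by [].
rewrite giry_int_prod1// giry_int_ret//.
exact: (measurable_fun_fubini_tonelli_F (m2 := kx)).
Qed.

End Disintegration.

Section ConditionalMean.
Context {d d1 : measure_display} {T : measurableType d}
  {T1 : measurableType d1} {R : realType}.
Variables (P : probability T R) (Y : T -> T1) (X : T -> R).
Variable k : T1 -> probability R R.
Hypotheses (mY : measurable_fun [set: T] Y) (mX : measurable_fun [set: T] X).
Hypothesis kP : conditional_law P Y X k.

Let law := image_prob P Y mY.

Let mpos : measurable_fun [set: R] ((EFin : R -> \bar R)^\+)%E.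
Proof. by apply: measurable_funepos; exact: EFin_measurable. Qed.

Let mneg : measurable_fun [set: R] ((EFin : R -> \bar R)^\-)%E.
Proof. by apply: measurable_funeneg; exact: EFin_measurable. Qed.

Lemma measurable_kernel_integral (h : R -> \bar R) :
  measurable_fun [set: R] h -> (forall u, 0 <= h u)%E ->
  measurable_fun [set: T1] (fun y => \int[k y]_u h u)%E.
Proof.
move=> mh h0; apply: measurable_fun_integral_kernel => // U mU.
exact: kP.1.
Qed.

Lemma integral_kernel_preimage (h : R -> \bar R) (B : set T1) :
  measurable_fun [set: R] h -> (forall u, 0 <= h u)%E -> measurable B ->
  (\int[law]_(y in B) \int[k y]_u h u = \int[P]_(x in Y @^-1` B) h (X x))%E.
Proof.
move=> mh h0 mB.
have m1B : measurable_fun [set: T1] (fun y => (\1_B y)%:E : \bar R).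
  by apply/measurable_EFinP; exact: measurable_indic.
have mk := measurable_kernel_integral h mh h0.
have k0 y : (0 <= \int[k y]_u h u)%E by exact: integral_ge0.
transitivity (\int[P]_x ((\1_B (Y x))%:E * h (X x)))%E; last first.
  rewrite [RHS]integral_mkcond; apply: eq_integral => x _.
  rewrite patchE indicE; have [hB|hB] := pselect (B (Y x)).
    by rewrite !mem_set// mul1e.
  by rewrite !memNset// mul0e.
rewrite (ge0_integral_conditional_law P Y X k mY mX kP
  (fun yu => (\1_B yu.1)%:E * h yu.2)%E); last 2 first.
- by apply: emeasurable_funM; [exact: (measurableT_comp m1B)|exact: (measurableT_comp mh)].
- by move=> a; rewrite mule_ge0.
transitivity (\int[P]_x ((\1_B (Y x))%:E * \int[k (Y x)]_u h u))%E; last first.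
  by apply: eq_integral => x _ /=; rewrite ge0_integralZl.
rewrite -(ge0_integral_image_prob P _ mY (fun y => (\1_B y)%:E * \int[k y]_u h u)%E).
- rewrite [LHS]integral_mkcond; apply: eq_integral => y _.
  rewrite patchE indicE; have [hB|hB] := pselect (B y).
    by rewrite !mem_set// mul1e.
  by rewrite !memNset// mul0e.
- exact: emeasurable_funM.
- by move=> y; rewrite mule_ge0.
Qed.

Variable W : set T1.
Hypotheses (mW : measurable W)
  (iX : P.-integrable (Y @^-1` W) (EFin \o X)).

Let mean (y : T1) : \bar R := (\int[k y]_u u%:E)%E.

Let meanE : mean = ((fun y => \int[k y]_u ((EFin : R -> \bar R)^\+ u)) \-
  (fun y => \int[k y]_u ((EFin : R -> \bar R)^\- u)))%E.
Proof. by apply/funext => y; rewrite /mean [LHS]integralE. Qed.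

Lemma measurable_kernel_mean : measurable_fun [set: T1] mean.
Proof.
rewrite meanE.
by apply: emeasurable_funB; exact: measurable_kernel_integral.
Qed.

Let mYW : measurable (Y @^-1` W).
Proof. by rewrite -[X in measurable X]setTI; exact: mY. Qed.

Let ipos : law.-integrable W (fun y => \int[k y]_u ((EFin : R -> \bar R)^\+ u))%E.
Proof.
apply/integrableP; split.
  by apply: measurable_funTS; exact: measurable_kernel_integral.
under eq_integral do rewrite gee0_abs ?integral_ge0//.
rewrite integral_kernel_preimage//.
have /integrableP[_] := integrable_funepos mYW iX.
move=> h; rewrite (eq_integral (fun x => `|((EFin \o X)^\+) x|)%E)//= => x _.
by rewrite gee0_abs ?funepos_ge0// !funeposE.
Qed.

Let ineg : law.-integrable W (fun y => \int[k y]_u ((EFin : R -> \bar R)^\- u))%E.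
Proof.
apply/integrableP; split.
  by apply: measurable_funTS; exact: measurable_kernel_integral.
under eq_integral do rewrite gee0_abs ?integral_ge0//.
rewrite integral_kernel_preimage//.
have /integrableP[_] := integrable_funeneg mYW iX.
move=> h; rewrite (eq_integral (fun x => `|((EFin \o X)^\-) x|)%E)//= => x _.
by rewrite gee0_abs ?funeneg_ge0// !funenegE.
Qed.

Lemma integrable_kernel_mean : law.-integrable W mean.
Proof.
rewrite meanE.
exact: integrableB.
Qed.

(** Positive and negative parts are disintegrated separately. Both are integrable over W, so inside
    W their difference is legitimate although X may fail to be integrable globally. *)
Lemma integral_kernel_mean (B : set T1) : B `<=` W -> measurable B ->
  (\int[law]_(y in B) mean y = \int[P]_(x in Y @^-1` B) (X x)%:E)%E.
Proof.
move=> BW mB.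
rewrite meanE integralB//; last 2 first.
- exact: integrableS BW ipos.
- exact: integrableS BW ineg.
rewrite !integral_kernel_preimage// [RHS]integralE; congr (_ - _)%E.
- by apply: eq_integral => x _; rewrite !funeposE.
- by apply: eq_integral => x _; rewrite !funenegE.
Qed.

End ConditionalMean.

Lemma measurable_posterior_mean (R : realType) (d : measure_display)
    (T : measurableType d) (P : probability T R) (n : nat)
    (Y : T -> n.-tuple R) (X : T -> R) (k : n.-tuple R -> probability R R) :
  conditional_law P Y X k ->
  measurable_fun [set: n.-tuple R] (posterior_mean k).
Proof.
move=> hk; apply: (measurableT_comp (fine_measurable measurableT)).
exact: measurable_kernel_mean hk.
Qed.

(** * Conjugate Bayesian models *)

Section BayesModel.
Context {R : realType} {p : nat} {D : set 'rV[R]_p} (M : bayes_matern D).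
Local Notation P := (model_prob M).
Local Notation Q := (given_sill M).

(* The prior density vanishes outside ]0, +oo[, so this interval has the mass of
   the whole line; its normalization is never computed. *)
Lemma sill_gt0 : {ae P, forall x, 0 < sill M x}.
Proof.
have mpos : measurable (`]0, +oo[%classic : set R) by [].
have e1 : P (sill M @^-1` `]0, +oo[) = 1%E.
  rewrite sill_prior// -(probability_setT P).
  transitivity (P (sill M @^-1` setT)); last by rewrite preimage_setT.
  rewrite sill_prior// [LHS]integral_mkcond; apply: eq_integral => v _.
  rewrite patchE; case: ifPn => // vn0; rewrite /inverse_gamma_pdf ifN//.
  by apply: contra vn0 => v0; rewrite inE/= in_itv/= v0.
have mS : measurable (sill M @^-1` `]0, +oo[).
  by rewrite -[X in measurable X]setTI; exact: measurable_funPT.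
exists (~` (sill M @^-1` `]0, +oo[)); split.
- exact: measurableC.
- by rewrite probability_setC// e1 subee.
- by move=> x /= h; apply: contra_not h; rewrite in_itv/= andbT.
Qed.

Lemma ge0_integral_model (f : model_space M -> \bar R) :
  measurable_fun [set: model_space M] f -> (forall x, 0 <= f x)%E ->
  (\int[P]_x f x = \int[P]_x \int[Q (sill M x)]_y f y)%E.
Proof.
move=> mf f0.
apply: (ge0_integral_conditional_law P (sill M) id Q _ _ (given_sillP M)
  (fun vx => f vx.2)) => //.
exact: (measurableT_comp mf).
Qed.

Lemma measurable_given_integral (f : model_space M -> \bar R) :
  measurable_fun [set: model_space M] f -> (forall x, 0 <= f x)%E ->
  measurable_fun [set: model_space M] (fun x => \int[Q (sill M x)]_y f y)%E.
Proof.
move=> mf f0.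
have mI : measurable_fun [set: R] (fun v => \int[Q v]_y f y)%E.
  apply: measurable_fun_integral_kernel => // U mU.
  exact: (given_sillP M).1.
exact: (measurableT_comp mI).
Qed.

Lemma le_integral_model (f : model_space M -> \bar R) (C : R) :
  measurable_fun [set: model_space M] f -> (forall x, 0 <= f x)%E ->
  (forall v, 0 < v -> (\int[Q v]_x f x <= C%:E)%E) ->
  (\int[P]_x f x <= C%:E)%E.
Proof.
move=> mf f0 fC; rewrite ge0_integral_model//.
have C0 : 0 <= C.
  by rewrite -lee_fin; apply: le_trans (fC 1 ltr01); exact: integral_ge0.
apply: (@le_trans _ _ (\int[P]_x C%:E)%E).
  apply: ae_ge0_le_integral => //.
  - by move=> x _; exact: integral_ge0.
  - exact: measurable_given_integral.
  - by apply: filterS sill_gt0 => x v0 _; exact: fC.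
rewrite integral_cst// -[leRHS]mule1 lee_wpmul2l ?lee_fin//.
exact: probability_le1.
Qed.

Lemma eq_integral_model (f g : model_space M -> \bar R) :
  measurable_fun [set: model_space M] f -> (forall x, 0 <= f x)%E ->
  measurable_fun [set: model_space M] g -> (forall x, 0 <= g x)%E ->
  (forall v, 0 < v -> (\int[Q v]_x f x = \int[Q v]_x g x)%E) ->
  (\int[P]_x f x = \int[P]_x g x)%E.
Proof.
move=> mf f0 mg g0 fg; rewrite ge0_integral_model// [RHS]ge0_integral_model//.
apply: ge0_ae_eq_integral => //.
- exact: measurable_given_integral.
- exact: measurable_given_integral.
- by move=> x _; exact: integral_ge0.
- by move=> x _; exact: integral_ge0.
- by apply: filterS sill_gt0 => x v0 _; exact: fg.
Qed.

(** P A is the mean of [Q (sill M x) A], so this probability vanishes for almost every x, while the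
    sill is positive for almost every x; some x satisfies both. *)
Lemma model_null_given (A : set (model_space M)) : measurable A ->
  P A = 0%E -> exists2 v, 0 < v & Q v A = 0%E.
Proof.
move=> mA PA0; apply: contrapT => h.
have mQ : measurable_fun [set: model_space M] (fun x => Q (sill M x) A).
  have mQA : measurable_fun [set: R] (fun v => Q v A) by exact: (given_sillP M).1.
  exact: (measurableT_comp mQA).
have i0 : (\int[P]_x `|Q (sill M x) A| = 0)%E.
  have := (given_sillP M).2 A setT mA measurableT.
  rewrite preimage_setT setIT preimage_id PA0 => i0.
  by rewrite [RHS]i0; apply: eq_integral => x _; rewrite gee0_abs.
have aeQ := (ae_eq_integral_abs P measurableT mQ).1 i0.
have /negligibleP : {ae P, forall x, False}.
  apply: filterS2 sill_gt0 aeQ => x v0 /(_ I) QA0.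
  by apply: h; exists (sill M x).
rewrite (_ : ~` _ = setT); last by apply/seteqP; split => // x _ [].
move=> /(_ measurableT) => e; have /eqP := etrans (esym (probability_setT P)) e.
by rewrite onee_eq0.
Qed.

Variables (n : nat) (s : n.-tuple 'rV[R]_p) (s0 : 'rV[R]_p).
Hypotheses (us : uniq s) (s0s : s0 \notin s) (Ds : forall i, D (tnth s i))
  (Ds0 : D s0).
Local Notation Y := (data (latent M) (noise M) s).
Local Notation Z := (latent M s0).
Local Notation E := (noise M s0).

Let mY : measurable_fun [set: model_space M] Y.
Proof. exact: measurable_data. Qed.

(** A bound uniform in v survives averaging over the prior, whatever moments the prior has. *)
Lemma integrable_on_window (X : model_space M -> R) (W : set (n.-tuple R)) (C : R) :
  measurable_fun [set: model_space M] X -> measurable W ->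
  (forall v, 0 < v ->
    (\int[Q v]_x (`|X x|%:E * (\1_W (Y x))%:E) <= C%:E)%E) ->
  P.-integrable (Y @^-1` W) (EFin \o X).
Proof.
move=> mX mW h.
have m1W : measurable_fun [set: model_space M] (fun x => (\1_W (Y x))%:E : \bar R).
  have m1W : measurable_fun [set: n.-tuple R] (fun y => (\1_W y)%:E : \bar R).
    by apply/measurable_EFinP; exact: measurable_indic.
  exact: (measurableT_comp m1W mY).
apply/integrableP; split; first by apply: measurable_funTS; exact/measurable_EFinP.
apply: (@le_lt_trans _ _ C%:E); last exact: ltry.
rewrite integral_mkcond; apply: le_trans (le_integral_model _ _ _ _ h).
- rewrite le_eqVlt; apply/orP; left; apply/eqP; apply: eq_integral => x _.
  rewrite patchE indicE; have [hW|hW] := pselect (W (Y x)).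
    by rewrite !mem_set// mule1.
  by rewrite !memNset// mule0.
- apply: emeasurable_funM => //; apply/measurable_EFinP.
  exact: (measurableT_comp (@normr_measurable R setT) mX).
- by move=> x; rewrite mule_ge0// lee_fin.
Qed.

Lemma integrable_latent_window (i : 'I_n) (K : R) : 0 <= K ->
  P.-integrable (Y @^-1` window n i K) (EFin \o Z).
Proof.
move=> K0; apply: (integrable_on_window _ _
    (2 * K / Num.sqrt (nugget_ratio M) / Num.sqrt (pi *+ 2))).
- exact: measurable_funPT.
- exact: measurable_window.
- move=> v v0.
  exact: (latent_window_le _ _ _ v _ _ (nugget_ratio M) n s s0 v0
    (nugget_ratio_gt0 M) (given_sill_matern M v0) Ds Ds0 i K K0).
Qed.

Lemma integrable_noise_window (i : 'I_n) (K : R) : 0 <= K ->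
  P.-integrable (Y @^-1` window n i K) (EFin \o E).
Proof.
move=> K0; apply: (integrable_on_window _ _ (2 * K / Num.sqrt (pi *+ 2))).
- exact: measurable_funPT.
- exact: measurable_window.
- move=> v v0.
  exact: (noise_window_le _ _ _ v _ _ (nugget_ratio M) n s s0 v0
    (nugget_ratio_gt0 M) (given_sill_matern M v0)).
Qed.

(** Given v, the noise at s_0 is symmetric and independent of the data, so its positive and negative
    parts have equal integrals over the event. This equality passes through the prior; integrability
    makes the common value finite, so that the difference is 0. *)
Lemma integral_noise_data_eq0 (B : set (n.-tuple R)) : measurable B ->
  P.-integrable (Y @^-1` B) (EFin \o E) ->
  (\int[P]_(x in Y @^-1` B) (E x)%:E = 0)%E.
Proof.
move=> mB iE.
have mYB : measurable (Y @^-1` B) by rewrite -[X in measurable X]setTI; exact: mY.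
have m1B : measurable_fun [set: model_space M] (fun x => (\1_B (Y x))%:E : \bar R).
  have m1B : measurable_fun [set: n.-tuple R] (fun y => (\1_B y)%:E : \bar R).
    by apply/measurable_EFinP; exact: measurable_indic.
  exact: (measurableT_comp m1B mY).
have mpos : measurable_fun [set: R] (EFin : R -> \bar R)^\+%E.
  by apply: measurable_funepos; exact: EFin_measurable.
have mneg : measurable_fun [set: R] (EFin : R -> \bar R)^\-%E.
  by apply: measurable_funeneg; exact: EFin_measurable.
have mE : measurable_fun [set: model_space M] E by exact: measurable_funPT.
have cond (h : R -> \bar R) : (\int[P]_(x in Y @^-1` B) h (E x) =
    \int[P]_x (h (E x) * (\1_B (Y x))%:E))%E.
  rewrite integral_mkcond; apply: eq_integral => x _.
  rewrite patchE indicE; have [hB|hB] := pselect (B (Y x)).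
    by rewrite !mem_set// mule1.
  by rewrite !memNset// mule0.
have posneg : (\int[P]_(x in Y @^-1` B) ((EFin : R -> \bar R)^\+ (E x)) =
    \int[P]_(x in Y @^-1` B) ((EFin : R -> \bar R)^\- (E x)))%E.
  rewrite !cond; apply: eq_integral_model.
  - by apply: emeasurable_funM => //; exact: (measurableT_comp mpos).
  - by move=> x; rewrite mule_ge0.
  - by apply: emeasurable_funM => //; exact: (measurableT_comp mneg).
  - by move=> x; rewrite mule_ge0.
  - move=> v v0; have [_ _ _ wn ind] := given_sill_matern M v0.
    have dv : 0 < nugget_ratio M * v by rewrite mulr_gt0// nugget_ratio_gt0.
    rewrite !(integral_noise_data (Q v) (latent M) (noise M) _ wn ind n s s0 us s0s Ds Ds0)//.
    congr (_ * _)%E.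
    rewrite -(centered_normal_sym _ ((EFin : R -> \bar R)^\-)%E) ?sqrtr_gt0//.
    by apply: eq_integral => u _; rewrite funeposE funenegE EFinN oppeK.
have fin := integrable_neg_fin_num mYB iE.
rewrite integralE.
have -> : (\int[P]_(x in Y @^-1` B) ((fun x => (E x)%:E)^\+ x) =
    \int[P]_(x in Y @^-1` B) ((fun x => (E x)%:E)^\- x))%E.
  under eq_integral do rewrite funeposE; under [RHS]eq_integral do rewrite funenegE.
  under eq_integral do rewrite -(funeposE (EFin : R -> \bar R)).
  by under [RHS]eq_integral do rewrite -(funenegE (EFin : R -> \bar R)).
by rewrite subee.
Qed.

End BayesModel.

Section PosteriorMeans.
Context {R : realType} {p : nat} {D : set 'rV[R]_p} (M : bayes_matern D).
Local Notation P := (model_prob M).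
Variables (n : nat) (s : n.-tuple 'rV[R]_p) (s0 : 'rV[R]_p).
Hypotheses (us : uniq s) (s0s : s0 \notin s) (Ds : forall i, D (tnth s i))
  (Ds0 : D s0).
Local Notation Y := (data (latent M) (noise M) s).
Local Notation Z := (latent M s0).
Local Notation E := (noise M s0).
Local Notation X := (response (latent M) (noise M) s0).

(* An observation is needed (n > 0): without conditioning, the process need not
   be integrable when ig_shape <= 1/2. *)
Lemma posterior_means_eq (kz ky : n.-tuple R -> probability R R) (i : 'I_n) :
  latent_posterior M s s0 kz -> response_posterior M s s0 ky ->
  exists N : set (n.-tuple R), [/\ measurable N, P (Y @^-1` N) = 0%E &
    forall y, ~ N y -> posterior_mean ky y = posterior_mean kz y].
Proof.
move=> hz hy.
have mY : measurable_fun [set: model_space M] Y by exact: measurable_data.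
have mZ : measurable_fun [set: model_space M] Z by exact: measurable_funPT.
have mX : measurable_fun [set: model_space M] X by exact: measurable_funD.
have mW (m : R) : measurable (window n i m) by exact: measurable_window.
have mYpre B : measurable B -> measurable (Y @^-1` B).
  by move=> mB; rewrite -[X in measurable X]setTI; exact: mY.
have iZ (m : nat) : P.-integrable (Y @^-1` window n i m%:R) (EFin \o Z).
  exact: integrable_latent_window.
have iE (m : nat) : P.-integrable (Y @^-1` window n i m%:R) (EFin \o E).
  exact: integrable_noise_window.
have iX (m : nat) : P.-integrable (Y @^-1` window n i m%:R) (EFin \o X).
  apply: (eq_integrable _ ((EFin \o Z) \+ (EFin \o E))%E) => //.
    exact: mYpre.
  by apply: integrableD => //; exact: mYpre.
have aem (m : nat) : ae_eq (image_prob P Y mY) (window n i m%:R)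
    (fun y => \int[ky y]_u u%:E)%E (fun y => \int[kz y]_u u%:E)%E.
  apply: integral_ae_eq => //.
  - exact: (integrable_kernel_mean P Y X ky mY mX hy (window n i m%:R) (mW _) (iX m)).
  - by apply: measurable_funTS; exact: (measurable_kernel_mean P Y Z kz hz).
  - move=> B BW mB.
    rewrite (integral_kernel_mean P Y X ky mY mX hy _ (mW _) (iX m))//.
    rewrite (integral_kernel_mean P Y Z kz mY mZ hz _ (mW _) (iZ m))//.
    have sB : Y @^-1` B `<=` Y @^-1` window n i m%:R by move=> x; exact: BW.
    have iZB := integrableS (mYpre _ (mW _)) (mYpre _ mB) sB (iZ m).
    have iEB := integrableS (mYpre _ (mW _)) (mYpre _ mB) sB (iE m).
    under eq_integral do rewrite /response EFinD.
    rewrite integralD//; last exact: mYpre.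
    by rewrite (integral_noise_data_eq0 M n s s0 us s0s Ds Ds0 B mB iEB) adde0.
(* Only integer windows are used, so the exceptional sets have a null union. *)
have [N [mN N0 subN]] := ae_foralln aem.
exists N; split => // y Ny; rewrite /posterior_mean /Rintegral.
have /contrapT h : ~ ~ (forall m : nat, window n i m%:R y ->
    (\int[ky y]_u u%:E = \int[kz y]_u u%:E)%E).
  by move=> h; apply: Ny; exact: subN.
rewrite (h (Num.truncn `|tnth y i|).+1)//.
by rewrite /window/= in_itv/= -ler_norml ltW// truncnS_gt.
Qed.

End PosteriorMeans.

(** * Convergence of the squared error *)

Section SquaredErrors.
Context {d : measure_display} {T : measurableType d} {R : realType}.
Variable mu : {measure set T -> \bar R}.

(** Pointwise, the right side minus the left is (c f - g)^2 / c. Stated in the extended reals, the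
    bound also covers infinite integrals. *)
Lemma integral_sqr_add_le (f g : T -> R) (c : R) : 0 < c ->
  measurable_fun [set: T] f -> measurable_fun [set: T] g ->
  (\int[mu]_x ((f x + g x) ^+ 2)%:E <=
   (1 + c)%:E * \int[mu]_x (f x ^+ 2)%:E +
   (1 + c^-1)%:E * \int[mu]_x (g x ^+ 2)%:E)%E.
Proof.
move=> c0 mf mg.
have ci0 : 0 < c^-1 by rewrite invr_gt0.
have mf2 : measurable_fun [set: T] (fun x => (f x ^+ 2)%:E).
  by apply/measurable_EFinP; exact: measurable_funX.
have mg2 : measurable_fun [set: T] (fun x => (g x ^+ 2)%:E).
  by apply/measurable_EFinP; exact: measurable_funX.
have sq0 (h : T -> R) x : (0 <= (h x ^+ 2)%:E)%E by rewrite lee_fin sqr_ge0.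
have c1 : 0 <= 1 + c by rewrite addr_ge0// ltW.
have c2 : 0 <= 1 + c^-1 by rewrite addr_ge0// ltW.
rewrite -ge0_integralZl// -ge0_integralZl// -ge0_integralD//.
- apply: ge0_le_integral => //.
  + by move=> x _; rewrite lee_fin sqr_ge0.
  + by apply/measurable_EFinP/measurable_funX; exact: measurable_funD.
  + by apply: emeasurable_funD; exact: measurable_funeM.
  move=> x _; rewrite -!EFinM -EFinD lee_fin -subr_ge0.
  have -> : (1 + c) * f x ^+ 2 + (1 + c^-1) * g x ^+ 2 - (f x + g x) ^+ 2 =
      c^-1 * (c * f x - g x) ^+ 2 by field; lra.
  by rewrite mulr_ge0 ?sqr_ge0// ltW.
- by move=> x _; rewrite mule_ge0// lee_fin.
- exact: measurable_funeM.
- by move=> x _; rewrite mule_ge0// lee_fin.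
- exact: measurable_funeM.
Qed.

Lemma cvg_integral_sqr_add (e : T -> R) (X : nat -> T -> R) (t : R) :
  measurable_fun [set: T] e -> (forall n, measurable_fun [set: T] (X n)) ->
  (\int[mu]_x (e x ^+ 2)%:E = t%:E)%E ->
  (fun n => \int[mu]_x (X n x ^+ 2)%:E)%E @ \oo --> 0%E ->
  (fun n => \int[mu]_x ((e x + X n x) ^+ 2)%:E)%E @ \oo --> t%:E.
Proof.
move=> me mX et aC.
set a := (fun n => _) in aC; set b := (fun n => _).
have sqi (h : T -> R) : (0 <= \int[mu]_x (h x ^+ 2)%:E)%E.
  by apply: integral_ge0 => x _; rewrite lee_fin sqr_ge0.
have t0 : 0 <= t by rewrite -lee_fin -et.
have a0 n : (0 <= a n)%E by exact: sqi.
have b0 n : (0 <= b n)%E by exact: sqi.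
have ub c n : 0 < c -> (b n <= (1 + c)%:E * t%:E + (1 + c^-1)%:E * a n)%E.
  by move=> c0; rewrite -et; exact: integral_sqr_add_le.
(* The same inequality, applied to e = (e + X_n) - X_n. *)
have lb c n : 0 < c -> (t%:E <= (1 + c)%:E * b n + (1 + c^-1)%:E * a n)%E.
  move=> c0.
  have mN : measurable_fun [set: T] (fun x => - X n x).
    exact: (measurableT_comp (@oppr_measurable R setT) (mX n)).
  have h := integral_sqr_add_le (fun x => e x + X n x) _ c c0
    (measurable_funD me (mX n)) mN.
  rewrite -et (eq_integral (fun x => ((e x + X n x + - X n x) ^+ 2)%:E)); last first.
    by move=> x _; rewrite addrK.
  suff -> : a n = (\int[mu]_x ((- X n x) ^+ 2)%:E)%E by [].
  by apply: eq_integral => x _; rewrite sqrrN.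
have [af afC] := (fine_cvgP _ _).1 aC.
have bf : \forall n \near \oo, b n \is a fin_num.
  near=> n; have an : a n \is a fin_num by near: n.
  rewrite ge0_fin_numE//; apply: le_lt_trans (ub 1 n ltr01) _.
  by rewrite -(fineK an) -!EFinM -EFinD ltry.
apply/fine_cvgP; split => //.
apply/cvgrPdist_le => /= eps eps0.
(* In the lower bound c multiplies b_n, which the upper bound has put below t + eps; hence c (t +
   eps) <= eps / 2 is required and not only c t <= eps / 2. *)
pose c := eps / (2 * (t + eps + 1)).
have c0 : 0 < c by rewrite divr_gt0// mulr_gt0// ltr_wpDl// addr_ge0// ltW.
have ci0 : 0 < 1 + c^-1 by rewrite addr_gt0// invr_gt0.
have ct : c * (t + eps) <= eps / 2.
  have -> : eps / 2 = c * (t + eps + 1).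
    by rewrite /c; clear - t0 eps0; field; lra.
  by rewrite ler_wpM2l// ?(ltW c0)// lerDl.
have eta0 : 0 < eps / (2 * (1 + c^-1)) by rewrite divr_gt0// mulr_gt0.
near=> n.
have an : a n \is a fin_num by near: n.
have bn : b n \is a fin_num by near: n.
have al : (1 + c^-1) * fine (a n) <= eps / 2.
  have : `|0 - fine (a n)| <= eps / (2 * (1 + c^-1)).
    by near: n; move/cvgrPdist_le : afC; apply.
  rewrite sub0r normrN ger0_norm ?fine_ge0// => h.
  rewrite -ler_pdivlMl//; apply: le_trans h _.
  by rewrite invfM mulrA mulrC.
have := ub c n c0; have := lb c n c0.
rewrite -(fineK an) -(fineK bn) -!EFinM -!EFinD !lee_fin => h1 h2.
have b0' : 0 <= fine (b n) by rewrite fine_ge0.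
have ceps : 0 <= c * eps by rewrite mulr_ge0// ltW.
have {}c0 := ltW c0.
move: (fine (a n)) (fine (b n)) al h1 h2 b0' => alpha beta al h1 h2 b0'.
clear - t0 eps0 ct ceps c0 al h1 h2 b0'; clearbody c.
have h3 : beta <= t + eps by lra.
have h4 : c * beta <= c * (t + eps) by rewrite ler_wpM2l.
rewrite [fine _]/=.
by rewrite ler_norml; apply/andP; split; lra.
Unshelve. all: by end_near.
Qed.

End SquaredErrors.

Section ConvexCombination.
Context {R : realFieldType}.

(** Jensen's inequality as a variance identity: the weighted mean of the (z - m_g)^2 minus X^2 is
    the weighted mean of the (z - m_g - X)^2. Bounding each weight by 1 then removes the
    data-dependent weights, which may be correlated with the errors. *)
Lemma sqr_convex_comb_le (G : nat) (w m : 'I_G -> R) (z : R) :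
  \sum_(g < G) w g = 1 -> (forall g, 0 <= w g) ->
  (z - \sum_(g < G) w g * m g) ^+ 2 <= \sum_(g < G) (z - m g) ^+ 2.
Proof.
move=> w1 w0; set X := z - _.
have XE : X = \sum_(g < G) w g * (z - m g).
  rewrite /X -[z in LHS]mul1r -w1 mulr_suml -sumrB.
  by apply: eq_bigr => g _; rewrite mulrBr.
have wle1 g : w g <= 1.
  by rewrite -w1 (bigD1 g)//= lerDl sumr_ge0.
apply: (@le_trans _ _ (\sum_(g < G) w g * (z - m g) ^+ 2)); last first.
  by apply: ler_sum => g _; rewrite ler_piMl ?sqr_ge0.
rewrite -subr_ge0.
have -> : \sum_(g < G) w g * (z - m g) ^+ 2 - X ^+ 2 =
    \sum_(g < G) w g * ((z - m g) - X) ^+ 2.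
  transitivity (\sum_(g < G) w g * (z - m g) ^+ 2 -
      2 * X * (\sum_(g < G) w g * (z - m g)) + X ^+ 2 * \sum_(g < G) w g).
    by rewrite -XE w1; ring.
  rewrite !mulr_sumr -sumrB -big_split/=.
  by apply: eq_bigr => g _; ring.
by apply: sumr_ge0 => g _; rewrite mulr_ge0 ?sqr_ge0.
Qed.

End ConvexCombination.

Section StackedPrediction.
Context {R : realType} {p : nat} {D : set 'rV[R]_p}.
Context {d : measure_display} {T : measurableType d} (P : probability T R).
Variables (z e : 'rV[R]_p -> {mfun T >-> R}) (sigma2 phi nu tau2 : R).
Hypotheses (tau2_gt0 : 0 < tau2) (mm : matern_model P D z e sigma2 phi nu tau2).

Lemma noise_second_moment (s : 'rV[R]_p) : D s ->
  (\int[P]_x (e s x ^+ 2)%:E = tau2%:E)%E.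
Proof.
move=> Ds; have [_ _ _ wn _] := mm.
have mes : measurable_fun [set: T] (e s) by exact: measurable_funPT.
have msq : measurable_fun [set: R] (fun u : R => (u ^+ 2)%:E).
  by apply/measurable_EFinP; exact: measurable_funX.
have sq0 (u : R) : (0 <= (u ^+ 2)%:E)%E by rewrite lee_fin sqr_ge0.
rewrite -(ge0_integral_image_prob P _ mes (fun u => (u ^+ 2)%:E))//.
transitivity (\int[centered_normal (Num.sqrt tau2)]_u (u ^+ 2)%:E)%E.
  by apply: eq_measure_integral => A mA _; exact: wn.2.
rewrite ge0_integral_centered_normal// normal_prob_second_moment ?sqrtr_gt0//.
by rewrite sqr_sqrtr// ltW.
Qed.

Variables (n : nat) (s : n.-tuple 'rV[R]_p) (s0 : 'rV[R]_p).
Hypotheses (us : uniq s) (s0s : s0 \notin s) (Ds : forall i, D (tnth s i))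
  (Ds0 : D s0).

(** The exceptional set is null under the mixture law of M, hence under its conditional law for some
    sill v > 0; that is a Matern model, whose null data sets are null under P. *)
Lemma ae_posterior_means_eq (M : bayes_matern D)
    (kz ky : n.-tuple R -> probability R R) (i : 'I_n) :
  latent_posterior M s s0 kz -> response_posterior M s s0 ky ->
  {ae P, forall x, posterior_mean ky (data z e s x) =
                   posterior_mean kz (data z e s x)}.
Proof.
move=> hz hy; have [_ _ _ wn ind] := mm.
have [N [mN N0 eqN]] := posterior_means_eq M n s s0 us s0s Ds Ds0 kz ky i hz hy.
have mYN d' (T' : measurableType d') (z' e' : 'rV[R]_p -> {mfun T' >-> R}) :
    measurable (data z' e' s @^-1` N).
  by rewrite -[X in measurable X]setTI; exact: measurable_data.
have [v v0 QN0] := model_null_given M _ (mYN _ _ _ _) N0.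
have [_ _ _ wnM indM] := given_sill_matern M v0.
exists (data z e s @^-1` N); split; first exact: mYN.
  have tM : 0 < nugget_ratio M * v by rewrite mulr_gt0// nugget_ratio_gt0.
  exact: (data_null_dominates _ _ _ _ (given_sill M v) P _ _ _ _ _ _ n s N
    tM tau2_gt0 wnM indM wn ind us Ds mN QN0).
by move=> x /= h; apply: contrapT => nN; apply: h; exact: eqN.
Qed.

Variables (G : nat) (w : 'I_G -> n.-tuple R -> R) (m : 'I_G -> n.-tuple R -> R).
Hypotheses (mw : forall g, measurable_fun [set: n.-tuple R] (w g))
  (mmean : forall g, measurable_fun [set: n.-tuple R] (m g)).
Hypothesis hw : {ae P, forall x, \sum_(g < G) w g (data z e s x) = 1 /\
  forall g, 0 <= w g (data z e s x)}.

Definition latent_error (x : T) : R :=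
  z s0 x - \sum_(g < G) w g (data z e s x) * m g (data z e s x).

Lemma measurable_latent_error : measurable_fun [set: T] latent_error.
Proof.
have mY : measurable_fun [set: T] (data z e s) by exact: measurable_data.
apply: measurable_funB; first exact: measurable_funPT.
apply: measurable_sum => g.
by apply: measurable_funM; [exact: (measurableT_comp (mw g))|
  exact: (measurableT_comp (mmean g))].
Qed.

Lemma integral_sqr_latent_error_le :
  (\int[P]_x (latent_error x ^+ 2)%:E <=
   \sum_(g < G) \int[P]_x ((z s0 x - m g (data z e s x)) ^+ 2)%:E)%E.
Proof.
have mY : measurable_fun [set: T] (data z e s) by exact: measurable_data.
have mg g : measurable_fun [set: T] (fun x => ((z s0 x - m g (data z e s x)) ^+ 2)%:E).
  apply/measurable_EFinP; apply: measurable_funX; apply: measurable_funB => //.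
  exact: (measurableT_comp (mmean g)).
rewrite -ge0_integral_sum//; last by move=> g x _; rewrite lee_fin sqr_ge0.
apply: ae_ge0_le_integral => //.
- by move=> x _; rewrite lee_fin sqr_ge0.
- by apply/measurable_EFinP; apply: measurable_funX; exact: measurable_latent_error.
- by move=> x _; apply: sume_ge0 => g _; rewrite lee_fin sqr_ge0.
- exact: emeasurable_sum.
- apply: filterS hw => x [w1 w0] _; rewrite sumEFin lee_fin.
  exact: sqr_convex_comb_le.
Qed.

End StackedPrediction.

Theorem proposition3p3 (R : realType) (p : nat) (D : set 'rV[R]_p)
  (s : forall n : nat, n.-tuple 'rV[R]_p) (s0 : 'rV[R]_p)
  (hsD : forall n (i : 'I_n), D (tnth (s n) i))
  (hs_uniq : forall n, uniq (s n))
  (hs0D : D s0) (hs0 : forall n, s0 \notin s n)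
  (d0 : measure_display) (T0 : measurableType d0) (P0 : probability T0 R)
  (z e : 'rV[R]_p -> {mfun T0 >-> R})
  (sigma2 phi nu tau2 : R)
  (hsigma2 : 0 < sigma2) (hphi : 0 < phi) (hnu : 0 < nu) (htau2 : 0 < tau2)
  (hP0 : matern_model P0 D z e sigma2 phi nu tau2)
  (G : nat) (M : 'I_G -> bayes_matern D)
  (kz ky : 'I_G -> forall n : nat, n.-tuple R -> probability R R)
  (hkz : forall g n, latent_posterior (M g) (s n) s0 (kz g n))
  (hky : forall g n, response_posterior (M g) (s n) s0 (ky g n))
  (w : forall n : nat, 'I_G -> n.-tuple R -> R)
  (hw_meas : forall n g, measurable_fun [set: n.-tuple R] (w n g))
  (hw : forall n, {ae P0, forall x,
     \sum_(g < G) w n g (data z e (s n) x) = 1 /\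
     forall g, 0 <= w n g (data z e (s n) x)})
  (hE : forall g : 'I_G,
     (fun n : nat =>
        'E_P0[(fun x => (z s0 x -
           posterior_mean (kz g n) (data z e (s n) x)) ^+ 2)%R]%E)
       @ \oo --> 0%E) :
  (fun n : nat =>
     'E_P0[(fun x => (response z e s0 x -
        \sum_(g < G) w n g (data z e (s n) x) *
          posterior_mean (ky g n) (data z e (s n) x)) ^+ 2)%R]%E)
    @ \oo --> tau2%:E.
Proof.
have mz n g : measurable_fun [set: n.-tuple R] (posterior_mean (kz g n)).
  exact: (measurable_posterior_mean _ _ _ _ _ _ _ _ (hkz g n)).
have my n g : measurable_fun [set: n.-tuple R] (posterior_mean (ky g n)).
  exact: (measurable_posterior_mean _ _ _ _ _ _ _ _ (hky g n)).
pose X n := latent_error z e n (s n) s0 G (w n) (fun g => posterior_mean (kz g n)).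
have mX n : measurable_fun [set: T0] (X n) by exact: measurable_latent_error.
have me : measurable_fun [set: T0] (e s0) by exact: measurable_funPT.
have X2 : (fun n => \int[P0]_x (X n x ^+ 2)%:E)%E @ \oo --> 0%E.
  apply: (@squeeze_cvge _ _ _ _ (cst 0%E) _ (fun n => \sum_(g < G)
      'E_P0[(fun x => (z s0 x - posterior_mean (kz g n) (data z e (s n) x)) ^+ 2)%R])%E).
  - near=> n; apply/andP; split.
      by apply: integral_ge0 => x _; rewrite lee_fin sqr_ge0.
    rewrite expectation.unlock.
    exact: integral_sqr_latent_error_le.
  - exact: cvg_cst.
  - rewrite [X in _ --> X](_ : 0%E = (\sum_(g < G) (0 : \bar R))%E); last by rewrite big1.
    apply: cvg_nnesum => g _; last exact: hE.
    by near=> n; apply: expectation_ge0 => x; rewrite sqr_ge0.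
have main := cvg_integral_sqr_add P0 (e s0) X tau2 me mX
  (noise_second_moment P0 z e _ _ _ _ htau2 hP0 s0 hs0D) X2.
apply: cvg_trans main; apply: near_eq_cvg; near=> n.
(* The windows need an observation, so the posterior means are identified only for n > 0, which
   holds eventually. *)
have n0 : (0 < n)%N by near: n; exact: nbhs_infty_gt.
rewrite expectation.unlock; apply: ge0_ae_eq_integral => //.
- by apply/measurable_EFinP; apply: measurable_funX; exact: measurable_funD.
- apply/measurable_EFinP; apply: measurable_funX.
  apply: measurable_funB; first by apply: measurable_funD; exact: measurable_funPT.
  have mY : measurable_fun [set: T0] (data z e (s n)) by exact: measurable_data.
  apply: measurable_sum => g.
  by apply: measurable_funM; [exact: (measurableT_comp (hw_meas n g))|
    exact: (measurableT_comp (my n g))].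
- by move=> x _; rewrite lee_fin sqr_ge0.
- by move=> x _; rewrite lee_fin sqr_ge0.
have : {ae P0, forall x, forall g, posterior_mean (ky g n) (data z e (s n) x) =
    posterior_mean (kz g n) (data z e (s n) x)}.
  apply: filter_forall => g.
  apply: (ae_posterior_means_eq P0 z e _ _ _ _ htau2 hP0 n (s n) s0 (hs_uniq n)
    (hs0 n) (hsD n) hs0D (M g) _ _ (Ordinal n0) (hkz g n) (hky g n)).
apply: filterS => x hx _; congr (_ ^+ 2)%:E.
rewrite /X /latent_error /response addrA [e s0 x + _]addrC; congr (_ - _).
by apply: eq_bigr => g _; rewrite hx.
Unshelve. all: by end_near.
Qed.
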